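(* Let $\gamma\in\mathbb R$. If $u\in\mathbb H_2^{1,\gamma}(\mathbb B)\cap C(\mathbb B)$ is a weak supersolution of $$t^{-2}\Delta_{\mathbb B}u+t^{-2}(n-2)(t\partial_t u)+h(u)=f(t,x)\quad\text{in }\mathbb B,$$ then $u$ is a viscosity supersolution of this equation.
   Context: Standing setting. $n\ge 3$; $X\subset\mathbb R^{n-1}$ is a bounded convex open set with smooth boundary; $\mathbb B=(0,1)\times X$ with points $(t,x)$. The function $h:\mathbb R\to\mathbb R$ is continuous, non-increasing, $h(0)=0$; $f$ is continuous in $\mathbb B$. Operators. $\nabla_{\mathbb B}=(t\partial_t,\partial_{x_1},\dots,\partial_{x_{n-1}})$ and $\Delta_{\mathbb B}u=(t\partial_t)^2u+\sum_{i=1}^{n-1}\partial_{x_i}^2u$. Viscosity supersolution. $u\in LSC(\mathbb B)$ is a viscosity supersolution of the equation if for every $\phi\in C^2(\mathbb B)$ and every local minimum point $(t_0,x_0)\in\mathbb B$ of $u-\phi$ one has $t_0^{-2}\Delta_{\mathbb B}\phi(t_0,x_0)+t_0^{-2}(n-2)(t\partial_t\phi)(t_0,x_0)+h(u(t_0,x_0))\le f(t_0,x_0)$. Weighted spaces. With $d(x,\partial X)$ the Euclidean distance to $\partial X$, for $\gamma\in\mathbb R$ and $1\le q<\infty$, $$\|u\|_{\mathbb L^\gamma_q(\mathbb B)}=\left(\int_{\mathbb B}\big|(t(1-t)d(x,\partial X))^{\frac nq-\gamma}u\big|^q\frac{dt}{t}dx\right)^{1/q},$$ and $\mathbb L_q^\gamma(\mathbb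 B)$ is the space of distributions for which this is finite. $\mathbb H^{1,\gamma}_2(\mathbb B)$ is the space of distributions $u$ on $\mathbb B$ with $(t\partial_t)^\alpha\partial_x^\beta u\in\mathbb L^\gamma_2(\mathbb B)$ for all $\alpha\in\mathbb N$, $\beta\in\mathbb N^{n-1}$, $\alpha+|\beta|\le1$. Weak supersolution. $u\in\mathbb H^{1,\gamma}_2(\mathbb B)$ is a weak supersolution of the equation if $h(u)\in\mathbb L^n_{1,loc}(\mathbb B)$ (i.e. $\int_K|h(u)|\frac{dt}{t}dx<\infty$ for compact $K\subset\mathbb B$) and, for all non-negative $\psi\in C_0^\infty(\mathbb B)$, $$\int_{\mathbb B}t^{-2}\nabla_{\mathbb B}u\cdot\nabla_{\mathbb B}\psi\,\frac{dt}{t}dx\ge\int_{\mathbb B}\big(-f+h(u)+nt^{-2}(t\partial_tu)\big)\psi\,\frac{dt}{t}dx.$$ *)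

(* Defs.v *)
From HB Require Import structures.
From mathcomp Require Import all_boot all_order all_algebra.
From mathcomp Require Import all_classical all_reals all_analysis.

Set Implicit Arguments.
Unset Strict Implicit.
Unset Printing Implicit Defensive.

Import Order.TTheory GRing.Theory Num.Theory.
Import numFieldNormedType.Exports.

Local Open Scope classical_set_scope.
Local Open Scope ring_scope.

Definition rV_display : measure_display -> measure_display.
Proof. exact. Qed.

(* 'rV[T]_n carries the sigma-algebra generated by the n coordinate maps, as
   the library does for n.-tuple T. *)
Section measurable_rV.
Context {d : measure_display} {T : measurableType d} (n : nat).

Definition rV_coord (i : 'I_n) (x : 'rV[T]_n) : T := x ord0 i.

Let rV_set0 : g_sigma_preimage rV_coord set0.
Proof. exact: sigma_algebra0. Qed.

Let rV_setC A : g_sigma_preimage rV_coord A -> g_sigma_preimage rV_coord (~` A).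
Proof. exact: sigma_algebraC. Qed.

Let rV_bigcup (F : (set 'rV[T]_n)^nat) :
  (forall i, g_sigma_preimage rV_coord (F i)) ->
  g_sigma_preimage rV_coord (\bigcup_i (F i)).
Proof. exact: sigma_algebra_bigcup. Qed.

HB.instance Definition _ := @isMeasurable.Build (rV_display d)
  'rV[T]_n (g_sigma_preimage rV_coord) rV_set0 rV_setC rV_bigcup.

End measurable_rV.

Section measurable_rV_maps.
Context {d d' : measure_display} {S : measurableType d} {T : measurableType d'}.

Lemma measurable_rV_coord n (i : 'I_n) :
  measurable_fun [set: 'rV[T]_n] (@rV_coord d' T n i).
Proof.
move=> _ A mA; rewrite setTI; apply: sub_sigma_algebra.
case: n i => [[] []//|n i].
rewrite -bigcup_mkord_ord; exists i; first exact: ltn_ord.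
by exists A => //; rewrite inord_val setTI.
Qed.

Lemma measurable_fun_rVP n (f : S -> 'rV[T]_n) :
  measurable_fun [set: S] f <->
  forall i, measurable_fun [set: S] (@rV_coord d' T n i \o f).
Proof.
split=> [mf i|mf].
  exact: measurableT_comp (measurable_rV_coord i) mf.
apply: (measurability (\big[setU/set0]_(i < n)
  preimage_set_system setT (@rV_coord d' T n i) measurable)) => // _ [B + <-].
case: n => [|n] in f mf B *; first by rewrite big_ord0.
rewrite -bigcup_mkord_ord => -[i Ii [A mA <-]].
rewrite !setTI -comp_preimage -[X in measurable X]setTI.
exact: mf.
Qed.

End measurable_rV_maps.

Section lebesgue_rV.
Context {R : realType}.

Definition consrV n (p : R * 'rV[R]_n) : 'rV[R]_n.+1 :=
  row_mx (p.1)%:M p.2 : 'rV[R]_(1 + n).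

Lemma consrV0 n (p : R * 'rV[R]_n) : consrV p ord0 ord0 = p.1.
Proof.
by rewrite mxE; case: splitP => // j _; rewrite (ord1 j) mxE eqxx.
Qed.

Lemma consrVS n (p : R * 'rV[R]_n) (i : 'I_n) :
  consrV p ord0 (lift ord0 i) = p.2 ord0 i.
Proof.
rewrite mxE; case: splitP => [j|j /eqP]; first by rewrite (ord1 j).
by rewrite lift0 add1n eqSS => /eqP/val_inj ->.
Qed.

Lemma measurable_consrV n : measurable_fun [set: R * 'rV[R]_n] (@consrV n).
Proof.
apply/measurable_fun_rVP => i; case: (unliftP ord0 i) => [j ->|->].
  rewrite (_ : _ \o _ = @rV_coord _ R n j \o snd).
    exact: measurableT_comp (measurable_rV_coord j) measurable_snd.
  by apply/funext => p /=; rewrite /rV_coord consrVS.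
rewrite (_ : _ \o _ = fst); first exact: measurable_fst.
by apply/funext => p /=; rewrite /rV_coord consrV0.
Qed.

Section step.
Variables (n : nat) (mu : {sigma_finite_measure set 'rV[R]_n -> \bar R}).

Definition lebesgue_rVS : set 'rV[R]_n.+1 -> \bar R :=
  pushforward (@lebesgue_measure R \x mu)%E (@consrV n).

Let lebesgue_rVS0 : lebesgue_rVS set0 = 0%E.
Proof. by apply: measure0; exact: measurable_consrV. Qed.

Let lebesgue_rVS_ge0 A : (0 <= lebesgue_rVS A)%E.
Proof. by apply: measure_ge0; exact: measurable_consrV. Qed.

Let lebesgue_rVS_sigma_additive : semi_sigma_additive lebesgue_rVS.
Proof. by apply: measure_semi_sigma_additive; exact: measurable_consrV. Qed.

HB.instance Definition _ := isMeasure.Build _ _ _ lebesgue_rVS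
  lebesgue_rVS0 lebesgue_rVS_ge0 lebesgue_rVS_sigma_additive.

Let lebesgue_rVS_sigma_finite : sigma_finite setT lebesgue_rVS.
Proof.
have /sigma_finiteP[F [FT ndF Foo]] := sigma_finiteT (@lebesgue_measure R).
have /sigma_finiteP[G [GT ndG Goo]] := sigma_finiteT mu.
pose tl (x : 'rV[R]_n.+1) : 'rV[R]_n := \row_i x ord0 (lift ord0 i).
have mhd : measurable_fun setT (@rV_coord _ R n.+1 ord0).
  exact: measurable_rV_coord.
have mtl : measurable_fun setT tl.
  apply/measurable_fun_rVP => i.
  rewrite (_ : _ \o _ = @rV_coord _ R n.+1 (lift ord0 i)).
    exact: measurable_rV_coord.
  by apply/funext => x /=; rewrite /rV_coord mxE.
exists (fun k => @rV_coord _ R n.+1 ord0 @^-1` F k `&` tl @^-1` G k).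
  apply/esym; rewrite -subTset => x _.
  have [i _ Fi] : (\bigcup_i F i) (x ord0 ord0) by rewrite -FT.
  have [j _ Gj] : (\bigcup_i G i) (tl x) by rewrite -GT.
  exists (maxn i j) => //; split => /=.
    by move: Fi; exact/subsetPset/ndF/leq_maxl.
  by move: Gj; exact/subsetPset/ndG/leq_maxr.
move=> k; have [mF Fk] := Foo k; have [mG Gk] := Goo k; split.
  apply: measurableI; rewrite -[X in measurable X]setTI; first exact: mhd.
  exact: mtl.
rewrite /lebesgue_rVS /pushforward (_ : _ @^-1` _ = F k `*` G k).
  by rewrite product_measure1E// lte_mul_pinfty// ge0_fin_numE.
apply/seteqP; split=> -[t x] /=; rewrite /rV_coord consrV0.
  rewrite (_ : tl _ = x)//.
  by apply/rowP => i; rewrite mxE consrVS.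
rewrite (_ : tl _ = x)//.
by apply/rowP => i; rewrite mxE consrVS.
Qed.

HB.instance Definition _ := @Measure_isSigmaFinite.Build _ _ _
  lebesgue_rVS lebesgue_rVS_sigma_finite.

End step.

(* Lebesgue measure on R^n: a point mass for n = 0, then the product with the
   one-dimensional Lebesgue measure, carried to 'rV[R]_n.+1 by consrV. *)
Fixpoint lebesgue_rV n : {sigma_finite_measure set 'rV[R]_n -> \bar R} :=
  match n with
  | 0 => [the {sigma_finite_measure set 'rV[R]_0 -> \bar R} of \d_(0 : 'rV[R]_0)]
  | n'.+1 => [the {sigma_finite_measure set 'rV[R]_n'.+1 -> \bar R} of
               lebesgue_rVS (lebesgue_rV n')]
  end.

Lemma lebesgue_rV_box n (A : 'I_n -> set R) : (forall i, measurable (A i)) ->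
  lebesgue_rV n [set x | forall i, A i (x ord0 i)] =
  (\prod_(i < n) @lebesgue_measure R (A i))%E.
Proof.
elim: n A => [|n IH] A mA; first by rewrite big_ord0 /= diracE mem_set// => -[].
rewrite big_ord_recl -IH; last by move=> i; exact: mA.
have mB : measurable [set x : 'rV[R]_n | forall i, A (lift ord0 i) (x ord0 i)].
  rewrite (_ : [set _ | _] = \bigcap_(i in [set: 'I_n])
      (@rV_coord _ R n i @^-1` A (lift ord0 i))); last first.
    by apply/seteqP; split=> x /= H i //; move=> *; exact: H.
  apply: fin_bigcap_measurable => // i _.
  by rewrite -[X in measurable X]setTI; apply: measurable_rV_coord.
rewrite -product_measure1E//=; last exact: mA.
rewrite /lebesgue_rVS /pushforward; congr product_measure1.
apply/seteqP; split=> -[t x] /= => [H|[H0 H1] i].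
  split=> [|i]; first by have := H ord0; rewrite consrV0.
  by have := H (lift ord0 i); rewrite consrVS.
by case: (unliftP ord0 i) => [j ->|->]; rewrite ?consrVS// consrV0.
Qed.

End lebesgue_rV.

Section function_spaces.
Context {R : realType} {n : nat}.
Implicit Types (O : set 'rV[R]_n) (f u v : 'rV[R]_n -> R).

Definition partial (i : 'I_n) f (x : 'rV[R]_n) : R := 'D_(delta_mx ord0 i) f x.

(* f is of class C^k on the open set O; the values of f off O are irrelevant. *)
Fixpoint Ck (k : nat) O f : Prop :=
  {within O, continuous f} /\
  match k with
  | 0 => True
  | k'.+1 => forall i : 'I_n,
      (forall x, O x -> derivable f x (delta_mx ord0 i)) /\ Ck k' O (partial i f)
  end.

Definition smooth O f := forall k, Ck k O f.

(* C_0^oo(O), its elements being extended by zero to R^n. *)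
Definition test_function O f :=
  [/\ smooth setT f, compact (closure [set x | f x != 0]) &
      closure [set x | f x != 0] `<=` O].

Definition lower_semicontinuous_on O u :=
  forall x, O x -> forall a, a < u x ->
    \forall y \near within O (nbhs x), a < u y.

Definition euclidean_norm (x : 'rV[R]_n) : R :=
  Num.sqrt (\sum_i x ord0 i ^+ 2).

Definition dist (x : 'rV[R]_n) (A : set 'rV[R]_n) : R :=
  inf [set euclidean_norm (x - y) | y in A].

Definition boundary (A : set 'rV[R]_n) := closure A `\` A°.

(* Near each of its boundary points, A is a strict sublevel set of a smooth
   function without critical points. *)
Definition smooth_boundary (A : set 'rV[R]_n) :=
  forall x0, boundary A x0 -> exists (U : set 'rV[R]_n) (rho : 'rV[R]_n -> R),
    [/\ open U, U x0, smooth U rho,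
        (forall x, U x -> exists i, partial i rho x != 0) &
        A `&` U = [set x | U x /\ rho x < 0]].

Definition L1_loc O f := measurable_fun O f /\
  forall K, compact K -> K `<=` O ->
    (\int[lebesgue_rV n]_(x in K) (`|f x|)%:E < +oo)%E.

(* v represents the distributional derivative of u along the i-th axis. *)
Definition is_weak_partial O (i : 'I_n) u v :=
  [/\ L1_loc O u, L1_loc O v & forall psi, test_function O psi ->
    \int[lebesgue_rV n]_(x in O) (u x * partial i psi x) =
    - \int[lebesgue_rV n]_(x in O) (v x * psi x)].

Definition has_weak_partial O (i : 'I_n) u := exists v, is_weak_partial O i u v.

(* A representative of the weak derivative when there is one (it is unique up
   to null sets), and 0 otherwise. *)
Definition weak_partial O (i : 'I_n) u : 'rV[R]_n -> R :=
  xget (cst 0) [set v | is_weak_partial O i u v].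

End function_spaces.

(* The cone (0,1) x X. With X a subset of R^m, the dimension called n in the
   definitions of the weighted spaces and of the equation is m.+1; a point
   (t, x) is the row vector p with t = p 0 and x_i = p (i + 1). *)
Section cone.
Context {R : realType} {m : nat}.
Variable X : set 'rV[R]_m.
Implicit Types (p : 'rV[R]_m.+1) (u f phi : 'rV[R]_m.+1 -> R) (h : R -> R).

Definition tc p : R := p ord0 ord0.
Definition xc p : 'rV[R]_m := \row_i p ord0 (lift ord0 i).

Definition cone : set 'rV[R]_m.+1 := [set p | 0 < tc p < 1 /\ X (xc p)].

(* nabla_B = (t d_t, d_{x_1}, ..., d_{x_m}); index 0 is the t direction. *)
Definition cone_coef (i : 'I_m.+1) p : R := if i == ord0 then tc p else 1.
Definition cone_D (i : 'I_m.+1) phi p : R := cone_coef i p * partial i phi p.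
Definition weak_cone_D (i : 'I_m.+1) u p : R :=
  cone_coef i p * weak_partial cone i u p.

Definition cone_laplacian phi p : R :=
  cone_D ord0 (cone_D ord0 phi) p +
  \sum_(i < m) cone_D (lift ord0 i) (cone_D (lift ord0 i) phi) p.

Definition viscosity_supersolution h f u :=
  lower_semicontinuous_on cone u /\
  forall phi, Ck 2 cone phi -> forall p, cone p ->
    (\forall q \near within cone (nbhs p), u p - phi p <= u q - phi q) ->
    (tc p) ^- 2 * cone_laplacian phi p
      + (tc p) ^- 2 * (m.+1%:R - 2) * cone_D ord0 phi p + h (u p) <= f p.

Definition weighted_norm (gamma q : R) u : \bar R :=
  ((\int[lebesgue_rV m.+1]_(p in cone)
      (`| (tc p * (1 - tc p) * dist (xc p) (boundary X))
            `^ (m.+1%:R / q - gamma) * u p | `^ q / tc p)%:E) `^ q^-1)%E.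

Definition weighted_L (gamma q : R) u :=
  measurable_fun cone u /\ (weighted_norm gamma q u < +oo)%E.

(* Membership of a function in H^{1,gamma}_2: u and its first order derivatives
   in the sense of distributions belong to L^gamma_2. *)
Definition weighted_H1 (gamma : R) u :=
  weighted_L gamma 2 u /\
  forall i, has_weak_partial cone i u /\ weighted_L gamma 2 (weak_cone_D i u).

Definition cone_L1_loc u := measurable_fun cone u /\
  forall K, compact K -> K `<=` cone ->
    (\int[lebesgue_rV m.+1]_(p in K) (`|u p| / tc p)%:E < +oo)%E.

Definition weak_supersolution (gamma : R) h f u :=
  [/\ weighted_H1 gamma u, cone_L1_loc (h \o u) &
   forall psi, test_function cone psi -> (forall p, 0 <= psi p) ->
     \int[lebesgue_rV m.+1]_(p in cone)
       ((- f p + h (u p) + m.+1%:R * (tc p) ^- 2 * weak_cone_D ord0 u p)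
          * psi p / tc p) <=
     \int[lebesgue_rV m.+1]_(p in cone)
       ((tc p) ^- 2 * (\sum_i weak_cone_D i u p * cone_D i psi p) / tc p)].

End cone.

(* Main.v *)
(* In the variable log t the operator (t d_t)^2 + (n - 2) t d_t + Delta_x, with
   n = m + 1, has constant coefficients, so mollification of u in (log t, x)
   commutes with it.  The kernel at y = (s, x') is a product of a bump function of
   t / s (times 1 / s) and of bump functions of the differences x_i - x'_i; its
   total mass c does not depend on y.  Testing the weak inequality with t^3 times
   this kernel and moving all the derivatives of u onto the test function shows
   that the mollification W of u satisfies the classical differential inequality,
   with right-hand side the mollification of t^2 (f - h(u)).

   If phi touches u from below at p and violates the viscosity inequality there,
   then it does so near p with a margin.  The function
   W - c phi + c kappa |. - p|^2, with kappa small, has an interior minimum near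
   p as soon as W / c is close enough to u; the first and second derivative
   tests at that point contradict the inequality satisfied by W.  The derivatives
   fall on W and phi only, so no integration by parts is needed for phi, which is
   merely C^2. *)

Require Import Defs.
From mathcomp Require Import all_boot all_order all_algebra.
From mathcomp Require Import all_classical all_reals all_analysis.
From mathcomp Require Import measurable_realfun lebesgue_integral_under ring lra.

Set Implicit Arguments.
Unset Strict Implicit.
Unset Printing Implicit Defensive.

Import Order.TTheory GRing.Theory Num.Theory.
Import numFieldNormedType.Exports.

Local Open Scope classical_set_scope.
Local Open Scope ring_scope.

(** * Smooth functions on the line and a bump function *)

(** The weak formulation sees [u] only through smooth compactly supported tests, whereas the
    viscosity inequality is pointwise and [u] has no classical derivatives; the mollification
    supplies them. Since [u] is continuous, [f - h(u)] is handled as a given continuous function,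
    and what remains to be mollified is a linear inequality. The coefficients n, n - 2 and m in the
    three forms of the operator agree: integrating by parts against the weight t^-2 turns n into n -
    2, and expanding (t d_t)^2 = t^2 d_t^2 + t d_t turns n - 2 into n - 1 = m. Dilations have a
    price: the kernel in t has width proportional to s, and its derivatives blow up as s tends to 0.
    Bounds therefore hold only for s bounded below, and s <= 1 is what controls the supports.
    Product kernels reduce smoothness, partial derivatives, supports and total mass to facts about
    functions of one variable. The mass is left unnormalised: it only has to be finite, positive and
    the same for all centres. *)

Section smooth_line.
Context {R : realType}.
Implicit Types g h : R -> R.

Fixpoint line_Ck (k : nat) g : Prop :=
  match k with
  | 0 => continuous g
  | k'.+1 => (forall x, derivable g x 1) /\ line_Ck k' (derive1 g)
  end.

Definition line_smooth g := forall k, line_Ck k g.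

Lemma derivable_cts g : (forall x, derivable g x 1) -> continuous g.
Proof. by move=> dg x; apply/differentiable_continuous/derivable1_diffP. Qed.

Lemma line_CkW k g : line_Ck k.+1 g -> line_Ck k g.
Proof.
elim: k g => [|k IH] g; first by case=> dg _; exact: derivable_cts.
by case=> dg Cg; split=> //; exact: IH.
Qed.

Lemma line_smooth_derivable g x : line_smooth g -> derivable g x 1.
Proof. by move=> /(_ 1%N)[]. Qed.

Lemma line_smooth_continuous g : line_smooth g -> continuous g.
Proof. exact: (fun H => H 0%N). Qed.

Lemma line_smooth_derive1 g : line_smooth g -> line_smooth (derive1 g).
Proof. by move=> sg k; have [] := sg k.+1. Qed.

Lemma line_CkD k g h : line_Ck k g -> line_Ck k h -> line_Ck k (fun x => g x + h x).
Proof.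
elim: k g h => [|k IH] g h; first by move=> cg ch x; exact: cvgD (cg x) (ch x).
move=> [dg Cg] [dh Ch]; split=> [x|]; first exact: derivableD.
rewrite (_ : derive1 _ = fun x => (derive1 g) x + (derive1 h) x); first exact: IH.
by apply/funext => x; rewrite !derive1E deriveD.
Qed.

Lemma line_CkM k g h : line_Ck k g -> line_Ck k h -> line_Ck k (fun x => g x * h x).
Proof.
elim: k g h => [|k IH] g h; first by move=> cg ch x; exact: cvgM (cg x) (ch x).
move=> Cg Ch; have [dg Cg'] := Cg; have [dh Ch'] := Ch.
split=> [x|]; first exact: derivableM.
rewrite (_ : derive1 _ = fun x => g x * (derive1 h) x + h x * (derive1 g) x).
  by apply: line_CkD; apply: IH => //; exact: line_CkW.
by apply/funext => x; rewrite !derive1E deriveM.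
Qed.

Lemma line_smooth_cst (c : R) : line_smooth (fun=> c).
Proof.
move=> k; elim: k c => [|k IH] c; first by move=> x; exact: cvg_cst.
split=> [x|]; first exact: derivable_cst.
rewrite (_ : derive1 _ = fun=> 0); first exact: IH.
by apply/funext => x; rewrite derive1E derive_cst.
Qed.

Lemma line_smooth_id : line_smooth (@id R).
Proof.
case=> [|k]; first by move=> x; exact: cvg_id.
split=> [x|]; first exact: derivable_id.
rewrite (_ : derive1 _ = fun=> (1 : R)); first exact: line_smooth_cst.
by apply/funext => x; rewrite derive1E derive_id.
Qed.

Lemma line_smoothM g h :
  line_smooth g -> line_smooth h -> line_smooth (fun x => g x * h x).
Proof. by move=> sg sh k; exact: line_CkM. Qed.

Lemma line_smoothD g h :
  line_smooth g -> line_smooth h -> line_smooth (fun x => g x + h x).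
Proof. by move=> sg sh k; exact: line_CkD. Qed.

Lemma line_smoothX n : line_smooth (fun x : R => x ^+ n).
Proof.
elim: n => [|n IH]; first exact: line_smooth_cst.
rewrite (_ : (fun _ => _) = fun x => x * x ^+ n); last first.
  by apply/funext => x; rewrite exprS.
by apply: line_smoothM => //; exact: line_smooth_id.
Qed.

Lemma is_derive_affine (a b x : R) : is_derive x 1 (fun x => a * x + b) a.
Proof.
by apply: is_derive_eq; rewrite addr0 /GRing.scale /= mulr1.
Qed.

Lemma is_derive_comp_affine g (a b x : R) : derivable g (a * x + b) 1 ->
  is_derive x 1 (fun x => g (a * x + b)) (a * (derive1 g) (a * x + b)).
Proof.
move=> dg; have da := is_derive_affine a b x.
have dg' : is_derive (a * x + b) 1 g ((derive1 g) (a * x + b)).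
  by rewrite derive1E; exact: DeriveDef.
by rewrite mulrC; exact: is_derive1_comp.
Qed.

Lemma line_smooth_affine g (a b : R) :
  line_smooth g -> line_smooth (fun x => g (a * x + b)).
Proof.
move=> sg k; elim: k g sg => [|k IH] g sg.
  apply: derivable_cts => x.
  have dg : derivable g (a * x + b) 1 by exact: line_smooth_derivable.
  by have [] := is_derive_comp_affine dg.
have dg x : derivable g (a * x + b) 1 by exact: line_smooth_derivable.
split=> [x|]; first by have [] := is_derive_comp_affine (dg x).
rewrite (_ : derive1 _ = fun x => a * (derive1 g) (a * x + b)).
  apply: line_CkM; first exact: line_smooth_cst.
  exact/IH/line_smooth_derive1.
by apply/funext => x; rewrite derive1E; have [] := is_derive_comp_affine (dg x).
Qed.

End smooth_line.

Section bump.
Context {R : realType}.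
Implicit Types (p : {poly R}) (x y : R).

(** The polynomial factor makes the family p(1/x) exp(-1/x) stable under differentiation, so that
    smoothness follows by one induction over all [p]. *)
Definition flat p x : R := if 0 < x then p.[x^-1] * expR (- x^-1) else 0.

(** Each monomial obeys y^i <= i! exp(y), by the exponential series. *)
Lemma horner_le_expR p : exists C, forall y, 0 <= y -> `|p.[y]| <= C * expR y.
Proof.
exists (\sum_(i < size p) `|p`_i| * i`!%:R) => y y0.
rewrite horner_coef mulr_suml; apply: le_trans (ler_norm_sum _ _ _) _.
apply: ler_sum => i _; rewrite normrM (ger0_norm (exprn_ge0 _ y0)) -mulrA.
apply: ler_wpM2l => //.
have [->|/prednK i0] := posnP i.
  by rewrite expr0 fact0 mul1r; have := expR_ge1Dx y; lra.
have := @expR_ge1Dxn R y i.-1 y0; rewrite i0 => H.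
rewrite mulrC -ler_pdivrMr ?ltr0n ?fact_gt0//; lra.
Qed.

(** Comes from bounding p(y) y^2 by C exp(y) at y = 1/x. A quadratic bound is what makes the
    difference quotient at 0 vanish in the limit. *)
Lemma flat_le_sqr p : exists C, forall x, `|flat p x| <= C * x ^+ 2.
Proof.
have [C HC] := horner_le_expR (p * 'X^2).
have C0 : 0 <= C.
  have := HC 0 (lexx _); rewrite expR0 mulr1; exact/le_trans.
exists C => x; rewrite /flat; case: ifPn => [x0|_]; last first.
  by rewrite normr0 mulr_ge0// sqr_ge0.
have := HC x^-1; rewrite invr_ge0 => /(_ (ltW x0)).
rewrite hornerM hornerXn normrM normrX (normrM _ (expR _)).
rewrite (ger0_norm (expR_ge0 _)) expRN (gtr0_norm (_ : 0 < x^-1)) ?invr_gt0//.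
by rewrite exprVn !ler_pdivrMr ?expR_gt0 ?exprn_gt0// mulrAC.
Qed.

(** The chain rule gives x^-2 (p - p')(1/x) exp(-1/x), and x^-2 is the value of ['X^2] at 1/x. *)
Definition flat_derive p : {poly R} := 'X^2 * (p - deriv p).

Lemma is_derive_flat p x : is_derive x 1 (flat p) (flat (flat_derive p) x).
Proof.
have [x0|x0|->] := ltgtP x 0.
- rewrite (_ : flat _ x = 0); last by rewrite /flat ltNge ltW.
  apply: (@near_eq_is_derive _ _ _ (fun=> 0)).
  by near=> y; rewrite /flat ltNge ltW//; near: y; exact: lt_nbhsl.
- rewrite {2}/flat x0.
  apply: (@near_eq_is_derive _ _ _ (fun y => p.[y^-1] * expR (- y^-1))).
    by near=> y; rewrite /flat ifT//; near: y; exact: lt_nbhsr.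
  have xn0 : x != 0 by rewrite gt_eqF.
  have dV : is_derive x 1 (fun y : R => y^-1) (- x ^- 2).
    have := @is_deriveV R id x 1 1 xn0 (is_derive_id _ _).
    by rewrite /GRing.scale /= mulr1.
  have dp := is_derive1_comp (is_derive_poly p x^-1) dV.
  have dNV : is_derive x 1 (fun y : R => - y^-1) (x ^- 2).
    by rewrite -[x ^- 2]opprK; exact: is_deriveN.
  have de := @is_derive1_comp _ expR (fun y => - y^-1) _ _ _
    (is_derive_expR (- x^-1)) dNV.
  have := is_deriveM dp de; rewrite /GRing.scale /= => H.
  apply: is_derive_eq H _.
  by rewrite /flat_derive hornerM hornerD hornerN hornerXn; field.
(* At the junction point 0 the quotient is at most C |h| in absolute value, so the derivative is
   0. *)
have [C HC] := flat_le_sqr p.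
have C0 : 0 <= C by have := HC 1; rewrite expr1n mulr1; exact: le_trans.
rewrite {2}/flat ltxx.
have cv : h^-1 *: (flat p (h *: 1 + 0) - flat p 0) @[h --> 0^'] --> (0 : R).
  apply/cvgrPdist_lt => e e0; near=> h.
  have h0 : h != 0 by near: h; exact: nbhs_dnbhs_neq.
  rewrite addr0 [_ *: 1]mulr1 {2}/flat ltxx subr0 sub0r normrN.
  rewrite normrM normfV ltr_pdivrMl ?normr_gt0//.
  apply: le_lt_trans (HC h) _.
  rewrite -normr_id -real_normK ?num_real// normr_id expr2 mulrCA.
  rewrite ltr_pM2l ?normr_gt0//.
  have : `|h| < e / (C + 1).
    near: h; apply: dnbhs0_lt; apply: divr_gt0 => //; lra.
  rewrite ltr_pdivlMr; [|lra]; have := normr_ge0 h; nra.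
apply: DeriveDef; first by apply/cvg_ex; exists 0.
exact: cvg_lim cv.
Unshelve. all: by end_near.
Qed.

Lemma line_smooth_flat p : line_smooth (flat p).
Proof.
move=> k; elim: k p => [|k IH] p.
  by apply: derivable_cts => x; have [] := is_derive_flat p x.
split=> [x|]; first by have [] := is_derive_flat p x.
rewrite (_ : derive1 _ = flat (flat_derive p)); first exact: IH.
by apply/funext => x; rewrite derive1E; have [] := is_derive_flat p x.
Qed.

(** The product of exp(-1/(1+x)) and exp(-1/(1-x)), supported in [-1, 1]; the arguments are written
    in the shape a x + b of [line_smooth_affine]. *)
Definition bump x : R := flat 1 (1 * x + 1) * flat 1 (-1 * x + 1).

Lemma line_smooth_bump : line_smooth bump.
Proof. by apply: line_smoothM; exact/line_smooth_affine/line_smooth_flat. Qed.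

Lemma flat1_ge0 x : 0 <= flat 1 x.
Proof. by rewrite /flat; case: ifP => // _; rewrite hornerC mul1r expR_ge0. Qed.

Lemma bump_ge0 x : 0 <= bump x.
Proof. by rewrite mulr_ge0 ?flat1_ge0. Qed.

Lemma bump_out x : 1 <= `|x| -> bump x = 0.
Proof.
rewrite ler_normr /bump /flat => /orP[] x1.
  by rewrite [X in _ * X]ifF ?mulr0//; apply/negbTE; rewrite -leNgt; lra.
by rewrite ifF ?mul0r//; apply/negbTE; rewrite -leNgt; lra.
Qed.

Lemma bump0_gt0 : 0 < bump 0.
Proof.
rewrite /bump !mulr0 add0r /flat ltr01 hornerC mul1r.
by rewrite mulr_gt0 ?expR_gt0.
Qed.

End bump.

(** * Affine change of variables and the mass of the bump function *)

Section affine_integral.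
Context {R : realType}.
Implicit Types (g : R -> R).
Local Notation mu := (@lebesgue_measure R).

Lemma ge0_integral_affine g (a b : R) : 0 < a -> continuous g ->
  (forall x, 0 <= g x) ->
  (\int[mu]_x (g (a * x + b))%:E = a^-1%:E * \int[mu]_x (g x)%:E)%E.
Proof.
move=> a0 cg g0.
have F' x : derive1 (fun x : R => a * x + b) x = a.
  by rewrite derive1E; have [] := is_derive_affine a b x.
have F'E : derive1 (fun x : R => a * x + b) = fun=> a by apply/funext.
rewrite (@increasing_ge0_integration_by_substitutionT _
  (fun x => a * x + b) g) //.
- rewrite F'E -ge0_integralZl//; last by rewrite lee_fin invr_ge0 ltW.
  + apply: eq_integral => x _; rewrite -EFinM; congr EFin => /=.
    by rewrite !fctE /=; field; rewrite gt_eqF.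
  + apply/measurable_EFinP; apply: measurable_funM => //.
    apply: (measurableT_comp (f := g)); first exact: continuous_measurable_fun.
    apply: continuous_measurable_fun; apply: derivable_cts => x.
    by have [] := is_derive_affine a b x.
  + move=> x _; rewrite lee_fin; apply: mulr_ge0; first exact: g0.
    exact: ltW.
- by move=> x y xy; rewrite ltrD2r ltr_pM2l.
- by rewrite F'E => x; exact: cvg_cst.
- by rewrite F'E; exact: is_cvg_cst.
- by rewrite F'E; exact: is_cvg_cst.
- apply/cvgrNyPle => A; near=> x.
  rewrite -lerBrDr mulrC -ler_pdivlMr//; near: x.
- apply/cvgryPge => A; near=> x.
  rewrite -lerBlDr mulrC -ler_pdivrMr//; near: x.
Unshelve. all: by end_near.
Qed.

Lemma integral_bump :
  exists2 c : R, 0 < c & (\int[mu]_x (bump x)%:E = c%:E)%E.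
Proof.
have cb : continuous (@bump R) by exact/line_smooth_continuous/line_smooth_bump.
have mb : measurable_fun setT (@bump R) by exact: continuous_measurable_fun.
have intE : (\int[mu]_x (bump x)%:E = \int[mu]_(x in `[(-1)%R, 1%R]) (bump x)%:E)%E.
  rewrite [RHS]integral_mkcond; apply: eq_integral => x _.
  rewrite patchE; case: ifPn => //; rewrite notin_setE /= in_itv /= => x1.
  rewrite bump_out// leNgt; apply/negP => /ltW.
  by rewrite ler_norml.
have fin : (\int[mu]_x (bump x)%:E < +oo)%E.
  rewrite intE; have /integrableP[_] : mu.-integrable `[(-1 : R), 1] (EFin \o bump).
    apply: continuous_compact_integrable; first exact: segment_compact.
    exact: continuous_subspaceT.
  by under eq_integral do rewrite abse_EFin ger0_norm ?bump_ge0//.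
have ge0 : (0 <= \int[mu]_x (bump x)%:E)%E.
  by apply: integral_ge0 => x _; rewrite lee_fin bump_ge0.
(* Positivity of the mass: by continuity the bump exceeds half its central value on [-d/2, d/2]. *)
have [d /= d0 dP] : \forall x \near (0 : R), bump 0 / 2 < bump x.
  apply: (cvgr_gt (bump (0 : R)) (cb 0)).
  by rewrite ltr_pdivrMr// ltr_pMr ?bump0_gt0// ltr1n.
exists (fine (\int[mu]_x (bump x)%:E)); last by rewrite fineK// ge0_fin_numE.
apply: fine_gt0; rewrite fin andbT.
have lb : (\int[mu]_(x in `[(- (d / 2))%R, (d / 2)%R]) (bump (0:R) / 2)%R%:E
    <= \int[mu]_x (bump x)%:E)%E.
  apply: (@le_trans _ _ (\int[mu]_(x in `[(- (d / 2))%R, (d / 2)%R]) (bump x)%:E)%E).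
    apply: ge0_le_integral => //.
    - by move=> x _; rewrite lee_fin; apply: divr_ge0 => //; exact: bump_ge0.
    - by apply/measurable_EFinP; exact: measurable_funS mb.
    - move=> x; rewrite /= in_itv /= => xd; rewrite lee_fin ltW//; apply: dP => /=.
      rewrite sub0r normrN; apply: (@le_lt_trans _ _ (d / 2)); last lra.
      by rewrite ler_norml.
  apply: ge0_subset_integral => //; first exact/measurable_EFinP.
  by move=> x _; rewrite lee_fin bump_ge0.
apply: lt_le_trans lb; rewrite integral_cst//= lebesgue_measure_itv /=.
rewrite lte_fin ifT; last lra.
rewrite -EFinM lte_fin mulr_gt0//; last lra.
by rewrite divr_gt0 ?bump0_gt0.
Qed.

End affine_integral.

(** * Mollifying kernels in one variable *)

Section line_test.
Context {R : realType}.
Implicit Types (f g : R -> R).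

Lemma derive1_out g (a b : R) : (forall x, x \notin `[a, b] -> g x = 0) ->
  forall x, x \notin `[a, b] -> derive1 g x = 0.
Proof.
move=> g0 x xab; rewrite derive1E (near_eq_derive (g := fun=> 0)) ?derive_cst//.
have : open (~` [set` `[a, b]] : set R).
  by apply: closed_openC; exact: interval_closed.
rewrite openE => /(_ x); rewrite /= => /(_ (negP xab)).
by apply: filterS => y /= /negP; exact: g0.
Qed.

Definition line_test g := line_smooth g /\
  exists a b, forall x, x \notin `[a, b] -> g x = 0.

Lemma line_test_derive1 g : line_test g -> line_test (derive1 g).
Proof.
move=> [sg [a [b g0]]]; split; first exact: line_smooth_derive1.
by exists a, b; exact: derive1_out.
Qed.

Lemma line_testMl f g : line_smooth f -> line_test g ->
  line_test (fun x => f x * g x).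
Proof.
move=> sf [sg [a [b g0]]]; split; first exact: line_smoothM.
by exists a, b => x /g0 ->; rewrite mulr0.
Qed.

Lemma line_testD f g : line_test f -> line_test g ->
  line_test (fun x => f x + g x).
Proof.
move=> [sf [a [b f0]]] [sg [c [d g0]]]; split; first exact: line_smoothD.
exists (Order.min a c), (Order.max b d) => x; rewrite in_itv /= => H.
rewrite f0 ?g0 ?addr0// in_itv /=; apply: contra H => /andP[H1 H2].
  by rewrite ge_min le_max H1 H2 !orbT.
by rewrite ge_min le_max H1 H2.
Qed.

Lemma line_test_bounded g : line_test g -> exists M, forall x, `|g x| <= M.
Proof.
move=> [sg [a [b g0]]]; have cg := line_smooth_continuous sg.
have [ab|ba] := leP a b; last first.
  exists 0 => x; rewrite g0 ?normr0//.
  by rewrite in_itv /=; apply/negP => /andP[] ? ?; lra.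
have [|c cab Hc] := @EVT_max _ (fun x => `|g x|) a b ab.
  by apply: continuous_subspaceT => x; apply: cvg_norm; exact: cg.
exists `|g c| => x; have [/Hc//|/g0 ->] := boolP (x \in `[a, b]).
by rewrite normr0.
Qed.

Lemma line_test_affine g (a b : R) : 0 < a -> line_test g ->
  line_test (fun x => g (a * x + b)).
Proof.
move=> a0 [sg [c [d g0]]]; split; first exact: line_smooth_affine.
exists ((c - b) / a), ((d - b) / a) => x H; apply: g0; apply: contra H.
rewrite !in_itv /= ler_pdivrMr// ler_pdivlMr// => /andP[? ?].
by apply/andP; split; lra.
Qed.

Lemma line_test_bump : line_test (@bump R).
Proof.
split; first exact: line_smooth_bump.
exists (-1), 1 => x; rewrite in_itv /= -ler_norml -ltNge => /ltW.
exact: bump_out.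
Qed.

(** The profile for which the s-derivative of g(x/s) / s^k is again a dilated profile, now over
    s^(k+1); iterating it gives the higher derivatives of the kernel in t. *)
Definition dilation_derive (k : nat) g x : R := - (x * derive1 g x + k%:R * g x).

Lemma line_test_dilation_derive k g : line_test g -> line_test (dilation_derive k g).
Proof.
move=> tg; rewrite /dilation_derive.
under eq_fun do rewrite -mulN1r.
apply: line_testMl; first exact: line_smooth_cst.
apply: line_testD; apply: line_testMl => //.
- exact: line_smooth_id.
- exact: line_test_derive1.
- exact: line_smooth_cst.
Qed.

Lemma is_derive_dilation k g (x s : R) : 0 < s -> line_smooth g ->
  is_derive s 1 (fun s => g (x / s) / s ^+ k) (dilation_derive k g (x / s) / s ^+ k.+1).
Proof.
move=> s0 sg; have sn0 : s != 0 by rewrite gt_eqF.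
have dV : is_derive s 1 (fun s : R => x / s) (- x / s ^+ 2).
  have H := @is_deriveZ _ _ _ _ x _ _ _ (@is_deriveV R id s 1 1 sn0 (is_derive_id _ _)).
  by apply: is_derive_eq H _; rewrite /GRing.scale /=; field.
have dg : is_derive (x / s) 1 g (derive1 g (x / s)).
  by rewrite derive1E; apply: DeriveDef => //; exact: line_smooth_derivable.
have dgV := @is_derive1_comp _ g (fun s => x / s) _ _ _ dg dV.
have dX : is_derive s 1 (fun s : R => s ^+ k) (s ^+ k.-1 *+ k).
  have := @is_deriveX _ _ id k s 1 1 (is_derive_id _ _).
  by rewrite exprfctE /GRing.scale /= mulr1 mulr_natl.
have dXV := @is_deriveV R (fun s => s ^+ k) s _ 1 (expf_neq0 k sn0) dX.
have := is_deriveM dgV dXV; rewrite /GRing.scale /= => H.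
apply: is_derive_eq H _; rewrite /dilation_derive (exprS s k).
have -> : s ^+ k.-1 *+ k = k%:R * s ^+ k / s.
  by case: k {dX dXV} => [|k]; rewrite ?mul0r ?mulr0n//= exprS -mulr_natl; field.
have := expf_neq0 k sn0; move: (s ^+ k) (g (x / s)) (derive1 g (x / s)).
move=> P a b P0; by field; apply/andP.
Qed.

Lemma is_derive_translation g (x s : R) : line_smooth g ->
  is_derive s 1 (fun s => g (x - s)) (- derive1 g (x - s)).
Proof.
move=> sg; have dg : derivable g (-1 * s + x) 1 by exact: line_smooth_derivable.
have := is_derive_comp_affine dg; rewrite !mulN1r addrC.
by under eq_fun do rewrite mulN1r addrC.
Qed.

End line_test.

Section kernel.
Context {R : realType}.
Variable e : R.
Hypothesis e0 : 0 < e.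
Implicit Types (rad : bool) (s x : R).

(** Both profiles have radius [e]. This one is centred at 0, for differences x - s; [dprofile] is
    centred at 1, for ratios x / s. *)
Definition tprofile x : R := bump (e^-1 * x + 0).
Definition dprofile x : R := bump (e^-1 * x + (- e^-1)).

(* [rad] singles out the t coordinate, where translations are replaced by
   dilations. *)
Definition ker rad s x : R :=
  if rad then dprofile (x / s) / s ^+ 1 else tprofile (x - s).
Definition ker1 rad s x : R :=
  if rad then dilation_derive 1 dprofile (x / s) / s ^+ 2
  else - derive1 tprofile (x - s).
Definition ker2 rad s x : R :=
  if rad then dilation_derive 2 (dilation_derive 1 dprofile) (x / s) / s ^+ 3
  else derive1 (derive1 tprofile) (x - s).

Lemma line_test_tprofile : line_test tprofile.
Proof. by apply: line_test_affine; [rewrite invr_gt0|exact: line_test_bump]. Qed.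

Lemma line_test_dprofile : line_test dprofile.
Proof. by apply: line_test_affine; [rewrite invr_gt0|exact: line_test_bump]. Qed.

Let st := line_test_tprofile.
Let sd := line_test_dprofile.

Lemma is_derive_ker rad s x : (rad -> 0 < s) ->
  is_derive s 1 (ker rad ^~ x) (ker1 rad s x).
Proof.
case: rad => [/(_ isT) s0|_]; first exact: is_derive_dilation (proj1 sd).
exact: is_derive_translation (proj1 st).
Qed.

Lemma is_derive_ker1 rad s x : (rad -> 0 < s) ->
  is_derive s 1 (ker1 rad ^~ x) (ker2 rad s x).
Proof.
case: rad => [/(_ isT) s0|_].
  exact: is_derive_dilation (proj1 (line_test_dilation_derive _ sd)).
rewrite -[ker2 _ _ _]opprK; apply: is_deriveN.
exact: is_derive_translation (proj1 (line_test_derive1 st)).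
Qed.

Lemma ker_ge0 rad s x : (rad -> 0 < s) -> 0 <= ker rad s x.
Proof.
by case: rad => [/(_ isT) s0|_]; rewrite ?divr_ge0 ?bump_ge0// exprn_ge0// ltW.
Qed.

Let continuous_dil g k s : line_test g -> continuous (fun x => g (x / s) / s ^+ k).
Proof.
move=> [sg _] x; apply: cvgM; last exact: cvg_cst.
apply: (continuous_comp (f := fun x => x / s)).
  by apply: cvgM; [exact: cvg_id|exact: cvg_cst].
exact: line_smooth_continuous sg _.
Qed.

Let continuous_trans g s : line_test g -> continuous (fun x => g (x - s)).
Proof.
move=> [sg _] x; apply: (continuous_comp (f := fun x => x - s)).
  by apply: cvgB; [exact: cvg_id|exact: cvg_cst].
exact: line_smooth_continuous sg _.
Qed.

Lemma continuous_ker rad s : continuous (ker rad s).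
Proof. by case: rad; [exact: continuous_dil|exact: continuous_trans]. Qed.

Lemma continuous_ker1 rad s : continuous (ker1 rad s).
Proof.
case: rad; first exact/continuous_dil/line_test_dilation_derive.
by move=> x; apply: cvgN; exact: (continuous_trans (line_test_derive1 st)).
Qed.

Lemma continuous_ker2 rad s : continuous (ker2 rad s).
Proof.
case: rad.
  exact/continuous_dil/line_test_dilation_derive/line_test_dilation_derive.
exact/continuous_trans/line_test_derive1/line_test_derive1.
Qed.

Let bounded_dil g k (l : R) : line_test g -> 0 < l ->
  exists M : R, forall s x, l <= s -> `|g (x / s) / s ^+ k| <= M.
Proof.
move=> /line_test_bounded[M HM] l0; exists (M / l ^+ k) => s x ls.
have s0 : 0 < s by exact: lt_le_trans ls.
rewrite normrM normfV (gtr0_norm (exprn_gt0 k s0)).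
apply: ler_pM; [exact: normr_ge0|by rewrite invr_ge0 exprn_ge0 ?ltW|exact: HM|].
rewrite lef_pV2 ?posrE ?exprn_gt0//.
by apply: lerXn2r => //; rewrite nnegrE ltW.
Qed.

(** The powers of 1/s in the dilated kernels are bounded only for s >= l. A single bound for both
    kinds of kernel and two derivatives serves for dominated differentiation and Lipschitz
    estimates. *)
Lemma ker_bounded (l : R) : 0 < l -> exists M, forall rad s x, (rad -> l <= s) ->
  [/\ `|ker rad s x| <= M, `|ker1 rad s x| <= M & `|ker2 rad s x| <= M].
Proof.
move=> l0.
have [A1 H1] := bounded_dil 1 sd l0.
have [A2 H2] := bounded_dil 2 (line_test_dilation_derive 1 sd) l0.
have [A3 H3] := bounded_dil 3
  (line_test_dilation_derive 2 (line_test_dilation_derive 1 sd)) l0.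
have [A4 H4] := line_test_bounded st.
have [A5 H5] := line_test_bounded (line_test_derive1 st).
have [A6 H6] := line_test_bounded (line_test_derive1 (line_test_derive1 st)).
exists (`|A1| + `|A2| + `|A3| + `|A4| + `|A5| + `|A6|) => rad s x ls.
have le (y A : R) : y <= A -> y <= `|A| by move=> /le_trans; apply; exact: ler_norm.
have := (normr_ge0 A1, normr_ge0 A2, normr_ge0 A3, normr_ge0 A4, normr_ge0 A5,
  normr_ge0 A6) => -[[[[[? ?] ?] ?] ?] ?].
case: rad ls => [/(_ isT) ls|_].
  have /le ? := H1 s x ls; have /le ? := H2 s x ls; have /le ? := H3 s x ls.
  by split; lra.
have /le ? := H4 (x - s); have /le ? := H5 (x - s); have /le ? := H6 (x - s).
by rewrite /ker /ker1 /ker2 normrN; split; lra.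
Qed.

Lemma line_smooth_ker rad s : line_smooth (ker rad s).
Proof.
case: rad.
  apply: line_smoothM; last exact: line_smooth_cst.
  rewrite (_ : (fun _ => _) = fun x => dprofile (s^-1 * x + 0)).
    exact: line_smooth_affine (proj1 sd).
  by apply/funext => x; rewrite addr0 mulrC.
rewrite (_ : ker _ _ = fun x => tprofile (1 * x + (- s))).
  exact: line_smooth_affine (proj1 st).
by apply/funext => x; rewrite mul1r.
Qed.

(** For the dilated kernel x/s - 1 = (x - s)/s, so its support has radius e s; the assumption s <= 1
    gives the same radius [e] as in the translated case. *)
Lemma ker_out rad s x : (rad -> 0 < s <= 1) -> x \notin `[s - e, s + e] ->
  ker rad s x = 0.
Proof.
rewrite in_itv /= -ler_distl -ltNge => s01 xs.
have bump0 y : e < `|y| -> bump (e^-1 * y) = 0.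
  move=> ye; apply: bump_out; rewrite normrM gtr0_norm ?invr_gt0//.
  by rewrite mulrC ler_pdivlMr// mul1r ltW.
case: rad s01 => [/(_ isT)/andP[s0 s1]|_].
  rewrite /ker /dprofile (_ : _ + _ = e^-1 * ((x - s) / s)); last first.
    by field; rewrite !gt_eqF.
  rewrite bump0 ?mul0r// normrM normfV (gtr0_norm s0) ltr_pdivlMr//.
  by apply: le_lt_trans xs; rewrite ler_piMr// ltW.
by rewrite /ker /tprofile addr0 bump0.
Qed.

(** The factor 1/s of the dilated kernel cancels the Jacobian of x -> x/s, so both kinds have mass
    [e] times that of the bump, whatever s is. *)
Lemma integral_ker : exists2 c : R, 0 < c & forall rad s, (rad -> 0 < s) ->
  (\int[@lebesgue_measure R]_x (ker rad s x)%:E = c%:E)%E.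
Proof.
have [c c0 cE] := @integral_bump R; exists (e * c); first exact: mulr_gt0.
have cb : continuous (@bump R) by exact/line_smooth_continuous/line_smooth_bump.
move=> [] s => [/(_ isT) s0|_].
  under eq_integral.
    move=> x _; rewrite /ker /dprofile expr1 mulrC EFinM.
    rewrite (_ : e^-1 * (x / s) = (e * s)^-1 * x); last by field; rewrite !gt_eqF.
    over.
  rewrite ge0_integralZl//; last 3 first.
  - apply/measurable_EFinP; apply: continuous_measurable_fun => x.
    exact: (line_smooth_continuous (line_smooth_affine _ _ (@line_smooth_bump R))).
  - by move=> x _; rewrite lee_fin bump_ge0.
  - by rewrite lee_fin invr_ge0 ltW.
  rewrite ge0_integral_affine ?invr_gt0 ?mulr_gt0//; last exact: bump_ge0.
  by rewrite cE -!EFinM; congr EFin; field; rewrite !gt_eqF.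
under eq_integral.
  move=> x _; rewrite /ker /tprofile addr0 mulrBr.
  over.
rewrite ge0_integral_affine ?invr_gt0//; last exact: bump_ge0.
by rewrite cE -EFinM invrK.
Qed.

Let is_derive_dil g k s x : line_smooth g ->
  is_derive x 1 (fun x => g (x / s) / s ^+ k) (derive1 g (x / s) / s ^+ k.+1).
Proof.
move=> sg; have dg : derivable g (s^-1 * x + 0) 1 by exact: line_smooth_derivable.
have H := is_deriveM (is_derive_comp_affine dg) (is_derive_cst (s ^- k) x 1).
rewrite (_ : (fun _ => _) = (fun x => g (s^-1 * x + 0)) * cst (s ^- k)); last first.
  by apply/funext => y; rewrite fctE addr0 [y / s]mulrC.
apply: is_derive_eq H _; rewrite scaler0 add0r /GRing.scale /= addr0.
by rewrite [s^-1 * x]mulrC exprS invfM; ring.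
Qed.

Let derive1_ker s : derive1 (ker true s) = fun x => derive1 dprofile (x / s) / s ^+ 2.
Proof.
apply/funext => x; rewrite derive1E.
by have [] := is_derive_dil 1 s x (proj1 sd).
Qed.

(* In the variable log t, the operator s^2 d^2/ds^2 + N s d/ds and its formal
   adjoint in t have constant coefficients and [ker true s t] is, up to the
   factor 1/t, a function of t/s: the two operators agree on it. *)
Lemma ker_adjoint (N s x : R) : 0 < s ->
  derive1 (fun x => x ^+ 2 * derive1 (ker true s) x + (2 - N) * (x * ker true s x)) x
  = s ^+ 2 * ker2 true s x + N * (s * ker1 true s x).
Proof.
move=> s0; rewrite derive1_ker derive1E.
have d1 := is_derive_dil 1 s x (proj1 sd).
have d2 := is_derive_dil 2 s x (proj1 (line_test_derive1 sd)).
have dX := @is_deriveX _ _ id 2 x 1 1 (is_derive_id _ _).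
have dA := is_deriveM dX d2.
have dB := is_deriveM (is_derive_id x (1 : R)) d1.
have [_ ->] := is_deriveD dA (is_deriveZ (2 - N) dB).
rewrite /ker2 /ker1.
(* Expanded numerator of the second s-derivative: z^2 g'' + 4 z g' + 2 g at z = x/s, with g =
   [dprofile]. *)
have -> : dilation_derive 2 (dilation_derive 1 dprofile) (x / s) =
    (x / s) ^+ 2 * derive1 (derive1 dprofile) (x / s) +
    4 * (x / s) * derive1 dprofile (x / s) + 2 * dprofile (x / s).
  rewrite {1}/dilation_derive.
  have -> : derive1 (dilation_derive 1 dprofile) (x / s) =
     - ((x / s) * derive1 (derive1 dprofile) (x / s) + 2 * derive1 dprofile (x / s)).
    have dp (g : R -> R) (y : R) : line_smooth g -> is_derive y 1 g (derive1 g y).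
      move=> sg; rewrite derive1E; apply: DeriveDef => //.
      exact: line_smooth_derivable.
    have D0 := dp _ (x / s) (proj1 sd).
    have D1 := dp _ (x / s) (proj1 (line_test_derive1 sd)).
    have D := is_deriveN (is_deriveD (is_deriveM (is_derive_id (x / s) (1 : R)) D1)
      (is_deriveZ 1 D0)).
    by rewrite derive1E; have [_ ->] := D; rewrite /GRing.scale /=; ring.
  by rewrite /dilation_derive; ring.
rewrite /dilation_derive /GRing.scale /= exprfctE.
move: (dprofile _) (derive1 dprofile _) (derive1 (derive1 dprofile) _) => a b c.
by field; rewrite gt_eqF.
Qed.

Lemma derive2_ker_false s : derive1 (derive1 (ker false s)) = ker2 false s.
Proof.
have dt (g : R -> R) : line_smooth g ->
    derive1 (fun x => g (x - s)) = fun x => derive1 g (x - s).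
  move=> sg; apply/funext => x; rewrite derive1E.
  have dg : derivable g (1 * x + - s) 1 by exact: line_smooth_derivable.
  have [_] := is_derive_comp_affine dg; rewrite !mul1r.
  by under eq_fun do rewrite mul1r.
rewrite /ker /ker2 dt; last exact: (proj1 st).
by rewrite dt//; exact: (proj1 (line_test_derive1 st)).
Qed.

End kernel.

(** * Products of functions of one variable *)

Section tensor.
Context {R : realType} {n : nat}.
Implicit Types (a : 'I_n -> R -> R) (q : 'rV[R]_n) (f : 'rV[R]_n -> R).

(** Written as r times the i-th basis vector plus a remainder free of r, so that adding a multiple
    of that vector merely shifts r. Partial derivatives thereby become one-variable derivatives. *)
Definition setc q (i : 'I_n) (r : R) : 'rV[R]_n :=
  r *: delta_mx ord0 i + (q - q ord0 i *: delta_mx ord0 i).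

Lemma setcE q i r j : setc q i r ord0 j = if j == i then r else q ord0 j.
Proof.
rewrite !mxE eqxx /=; case: eqP => [->|_]; last by rewrite !mulr0 add0r subr0.
by rewrite !mulr1 subrr addr0.
Qed.

Lemma setc_id q i : setc q i (q ord0 i) = q.
Proof. by rewrite /setc addrC subrK. Qed.

Lemma is_derive_setc f q i r d :
  is_derive (setc q i r) (delta_mx ord0 i) f d <->
  is_derive r 1 (fun r => f (setc q i r)) d.
Proof.
have E : (fun h => h^-1 *: ((f \o shift (setc q i r)) (h *: delta_mx ord0 i)
    - f (setc q i r))) =
  (fun h : R => h^-1 *: (((fun r => f (setc q i r)) \o shift r) (h *: 1)
    - f (setc q i r))).
  apply/funext => h /=; congr (_ *: (f _ - _)).
  by rewrite /setc addrA -scalerDl [h *: 1]mulr1.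
split=> -[dv dE]; apply: DeriveDef.
- by rewrite /derivable -E; exact: dv.
- by rewrite /derive -E; exact: dE.
- by rewrite /derivable E; exact: dv.
- by rewrite /derive E; exact: dE.
Qed.

Definition tens a q : R := \prod_j a j (q ord0 j).
Definition upd a (i : 'I_n) (g : R -> R) : 'I_n -> R -> R :=
  fun j => if j == i then g else a j.

Lemma tensD1 a q i :
  tens a q = a i (q ord0 i) * \prod_(j < n | j != i) a j (q ord0 j).
Proof. by rewrite /tens (bigD1 i). Qed.

Lemma tens_updE a q i g :
  tens (upd a i g) q = g (q ord0 i) * \prod_(j < n | j != i) a j (q ord0 j).
Proof.
rewrite (tensD1 _ _ i) /upd eqxx; congr (_ * _).
by apply: eq_bigr => j /negbTE ->.
Qed.

Lemma tens_setc a q i r :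
  tens a (setc q i r) = a i r * \prod_(j < n | j != i) a j (q ord0 j).
Proof.
rewrite (tensD1 _ _ i) setcE eqxx; congr (_ * _).
by apply: eq_bigr => j /negbTE ji; rewrite setcE ji.
Qed.

Lemma is_derive_tens a q i : derivable (a i) (q ord0 i) 1 ->
  is_derive q (delta_mx ord0 i) (tens a) (tens (upd a i (derive1 (a i))) q).
Proof.
move=> da; rewrite -{1}(setc_id q i); apply/is_derive_setc.
under eq_fun do rewrite tens_setc mulrC.
have D : is_derive (q ord0 i) 1 (a i) (derive1 (a i) (q ord0 i)).
  by rewrite derive1E; exact: DeriveDef.
have H := is_deriveZ (\prod_(j < n | j != i) a j (q ord0 j)) D.
by apply: is_derive_eq H _; rewrite tens_updE mulrC.
Qed.

Lemma partial_tens a i : (forall j, line_smooth (a j)) ->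
  partial i (tens a) = tens (upd a i (derive1 (a i))).
Proof.
move=> sa; apply/funext => q.
have [_ <-//] := is_derive_tens (q := q) (line_smooth_derivable (sa i)).
Qed.

Lemma continuous_tens a : (forall j, continuous (a j)) -> continuous (tens a).
Proof.
move=> ca; rewrite /tens; apply: continuous_big => //.
  by move=> x; apply: cvgM; [exact: cvg_fst|exact: cvg_snd].
move=> j _ q; apply: (continuous_comp (f := fun q : 'rV[R]_n => q ord0 j)).
  exact: coord_continuous.
exact: ca.
Qed.

Lemma line_smooth_upd a i g : (forall j, line_smooth (a j)) -> line_smooth g ->
  forall j, line_smooth (upd a i g j).
Proof. by move=> sa sg j; rewrite /upd; case: ifP. Qed.

Lemma smooth_tens a : (forall j, line_smooth (a j)) -> smooth setT (tens a).
Proof.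
move=> sa k; elim: k a sa => [|k IH] a sa /=.
  split=> //; apply: continuous_subspaceT; apply: continuous_tens => j.
  exact: line_smooth_continuous.
split=> [|i].
  apply: continuous_subspaceT; apply: continuous_tens => j.
  exact: line_smooth_continuous.
split=> [q _|].
  by have [] := is_derive_tens (q := q) (line_smooth_derivable (sa i)).
rewrite partial_tens//; apply: IH; apply: line_smooth_upd => //.
exact: line_smooth_derive1.
Qed.

Definition box (l r : 'I_n -> R) : set 'rV[R]_n :=
  [set q | forall j, `[l j, r j]%classic (q ord0 j)].

Lemma box_compact l r : compact (box l r).
Proof.
apply: (@rV_compact _ _ (fun j => `[l j, r j]%classic)) => j.
exact: segment_compact.
Qed.

Lemma tens_out a l r q : (forall j x, x \notin `[l j, r j] -> a j x = 0) ->
  ~ box l r q -> tens a q = 0.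
Proof.
by move=> a0 /existsNP[j /negP qj]; rewrite (tensD1 _ _ j) a0 ?mul0r.
Qed.

(** A box is closed and compact, hence contains the closure of the set where the product is
    nonzero. *)
Lemma test_function_tens a l r O : (forall j, line_smooth (a j)) ->
  (forall j x, x \notin `[l j, r j] -> a j x = 0) -> box l r `<=` O ->
  test_function O (tens a).
Proof.
move=> sa a0 bO.
have sub : closure [set q | tens a q != 0] `<=` box l r.
  have /closure_id -> : closed (box l r).
    by apply: compact_closed; [exact: norm_hausdorff|exact: box_compact].
  apply: closure_subset => q /= /eqP tq; apply: contrapT => /(tens_out a0).
  exact: tq.
split; first exact: smooth_tens.
- apply: subclosed_compact sub; [exact: closed_closure|exact: box_compact].
- exact: subset_trans sub bO.
Qed.

Lemma measurable_tens a D : (forall j, measurable_fun setT (a j)) ->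
  measurable_fun D (tens a).
Proof.
move=> ma; apply: (@measurable_funS _ _ _ _ setT) => //.
apply: measurable_prod => j _.
exact: measurableT_comp (ma j) (measurable_rV_coord j).
Qed.

Lemma measurable_box l r : measurable (box l r).
Proof.
rewrite (_ : box l r = \bigcap_(j in [set: 'I_n])
    (@rV_coord _ R n j @^-1` `[l j, r j]%classic)); last first.
  by apply/seteqP; split=> x /= H j //; move=> *; exact: H.
apply: fin_bigcap_measurable => // j _.
by rewrite -[X in measurable X]setTI; exact: measurable_rV_coord.
Qed.

Lemma box_fin l r : (lebesgue_rV n (box l r) < +oo)%E.
Proof.
rewrite (@lebesgue_rV_box _ _ (fun j => `[l j, r j]%classic)) => [|j]; last first.
  exact: measurable_itv.
suff /andP[] :
  (0 <= \prod_(j < n) @lebesgue_measure R `[l j, r j]%classic < +oo)%E by [].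
apply: (big_ind (fun x : \bar R => 0 <= x < +oo)%E).
- by rewrite lee_fin ler01 ltry.
- move=> x y /andP[x0 xoo] /andP[y0 yoo]; rewrite mule_ge0//=.
  by rewrite lte_mul_pinfty// ge0_fin_numE.
- move=> j _; rewrite measure_ge0/= lebesgue_measure_itv.
  by case: ifP => _; exact: ltry.
Qed.

End tensor.

(** * Open sets and continuous functions versus the coordinate sigma-algebra *)

Section rV_topology.
Context {R : realType} {n : nat}.
Implicit Types (x y : 'rV[R]_n) (O : set 'rV[R]_n).

Lemma rV_ballP x (e : R) y : 0 < e ->
  ball x e y <-> forall j, `|x ord0 j - y ord0 j| < e.
Proof.
move=> e0; split=> [[_ H] j|H]; first exact: (H ord0 j).
by split=> // i j; rewrite ord1; exact: H.
Qed.

(** The sigma-algebra is generated by the coordinates, not by the open sets; an open set is a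
    countable union of open cubes with rational centres and half-widths 1/(k+1), and these are
    measurable. *)
Lemma open_measurable_rV O : open O -> measurable O.
Proof.
move=> oO.
pose B (a : 'rV[rat]_n) (k : nat) : set 'rV[R]_n :=
  [set y | forall j, `|ratr (a ord0 j) - y ord0 j| < k.+1%:R^-1].
have mB a k : measurable (B a k).
  rewrite (_ : B a k = \bigcap_(j in [set: 'I_n]) (@rV_coord _ R n j @^-1`
    `](ratr (a ord0 j) - k.+1%:R^-1), (ratr (a ord0 j) + k.+1%:R^-1)[%classic)).
    apply: fin_bigcap_measurable => // j _.
    by rewrite -[X in measurable X]setTI; exact: measurable_rV_coord.
  apply/seteqP; split=> y /= H j; last have := H j I; rewrite ?/rV_coord /=.
    by move=> _; rewrite /rV_coord in_itv /= -ltr_distlC; exact: H.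
  by rewrite in_itv /= -ltr_distlC.
(* Enumerates all pairs (centre, k) through their codes, keeping only the cubes contained in [O]. *)
pose F k := if @unpickle ('rV[rat]_n * nat)%type k is Some (a, l) then
  if pselect (B a l `<=` O) then B a l else set0 else set0.
rewrite (_ : O = \bigcup_k F k).
  apply: bigcup_measurable => k _; rewrite /F; case: unpickle => [[a l]|] //.
  by case: pselect => ?; [exact: mB|exact: measurable0].
apply/seteqP; split=> [x Ox|x [k _]]; last first.
  by rewrite /F; case: unpickle => [[a l]|] //; case: pselect => // H; exact: H.
have /nbhs_ballP[e /= e0 eO] : nbhs x O by exact: open_nbhs_nbhs.
(* The rational centre will be within 1/(k+1) of [x] and the cube has half-width 1/(k+1), so two
   such steps must stay below [e]. *)
have [k ke] : exists k : nat, k.+1%:R^-1 < e / 2.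
  have [N _ HN] := near_infty_natSinv_lt (PosNum (divr_gt0 e0 (ltr0Sn R 1))).
  by exists N; apply: HN => /=.
have /choice[c Hc] : forall j, exists c : rat, `|ratr c - x ord0 j| < k.+1%:R^-1.
  move=> j; have : x ord0 j - k.+1%:R^-1 < x ord0 j + k.+1%:R^-1.
    have : 0 < k.+1%:R^-1 :> R by rewrite invr_gt0.
    by move: (k.+1%:R^-1 : R) => t; lra.
  by move=> /rat_in_itvoo[c]; rewrite in_itv /= -ltr_distl; exists c.
pose a : 'rV[rat]_n := \row_j c j.
exists (pickle (a, k)) => //; rewrite /F pickleK.
case: pselect => [? j|]; first by rewrite mxE.
case=> y By; apply: eO; apply/rV_ballP => // j.
have := By j; have := Hc j; rewrite mxE => H1 H2.
rewrite (_ : _ - _ = (x ord0 j - ratr (c j)) + (ratr (c j) - y ord0 j)); last by ring.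
rewrite (le_lt_trans (ler_normD _ _))//; move: H1 H2 ke; rewrite distrC.
by move: (k.+1%:R^-1 : R) => t; lra.
Qed.

Lemma continuous_measurable_rV O (f : 'rV[R]_n -> R) : open O ->
  {within O, continuous f} -> measurable_fun O f.
Proof.
move=> oO; rewrite continuous_open_subspace// => cf.
apply: (measurability _ (RGenOInfty.measurableE R)).
move=> /= _ [_ [a ->]] <-; apply: open_measurable_rV.
rewrite openE => q [Oq /=]; rewrite in_itv /= andbT => aq.
have cq : {for q, continuous f} by apply: cf; rewrite inE.
have H1 : \forall y \near q, O y by exact: open_nbhs_nbhs.
have H2 : \forall y \near q, a < f y by exact: (cvgr_gt _ cq).
near=> y; split; first by near: y.
by rewrite /= in_itv /= andbT; near: y.
Unshelve. all: by end_near.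
Qed.

End rV_topology.

Section integral_tens.
Context {R : realType}.
Local Open Scope ereal_scope.

(** Induction along the recursive construction of [lebesgue_rV]: undo the pushforward by [consrV],
    then apply Tonelli, for which nonnegativity suffices. *)
Lemma integral_tens n (a : 'I_n -> R -> R) :
  (forall j, measurable_fun setT (a j)) -> (forall j x, 0 <= a j x)%R ->
  \int[lebesgue_rV n]_q (tens a q)%:E =
  \prod_(j < n) \int[@lebesgue_measure R]_x (a j x)%:E.
Proof.
elim: n a => [|n IH] a ma a0.
  rewrite big_ord0; under eq_integral do rewrite /tens big_ord0.
  by rewrite integral_cst//= mul1e diracT.
rewrite big_ord_recl -IH//.
have t0 q : (0 <= tens a q)%R by apply: prodr_ge0.
set b := fun j : 'I_n => a (lift ord0 j).
have tE (z : R * 'rV[R]_n) : tens a (consrV z) = (a ord0 z.1 * tens b z.2)%R.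
  rewrite /tens big_ord_recl consrV0; congr (_ * _)%R.
  by apply: eq_bigr => j _; rewrite consrVS.
have b0 q : (0 <= tens b q)%R by apply: prodr_ge0 => j _; exact: a0.
rewrite ge0_integral_pushforward//; [|exact: measurable_consrV|
  by apply/measurable_EFinP; exact: measurable_tens|
  by move=> q _; rewrite lee_fin].
transitivity (\int[@lebesgue_measure R \x lebesgue_rV n]_z
    (a ord0 z.1 * tens b z.2)%R%:E).
  rewrite preimage_setT; apply: eq_integral => z _. by rewrite /= tE.
rewrite fubini_tonelli1//; last 2 first.
- apply/measurable_EFinP; apply: measurable_funM.
    exact: measurableT_comp (ma ord0) measurable_fst.
  apply: (measurableT_comp (f := tens b)); last exact: measurable_snd.
  by apply: measurable_tens => j; exact: ma.
- by move=> z; rewrite lee_fin mulr_ge0.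
rewrite /fubini_F; under eq_integral.
  move=> x _; under eq_integral do rewrite /= EFinM.
  rewrite ge0_integralZl//; last 3 first.
  - by apply/measurable_EFinP; apply: measurable_tens => j; exact: ma.
  - by move=> q _; rewrite lee_fin.
  - by rewrite lee_fin.
  over.
rewrite ge0_integralZr//.
- by apply/measurable_EFinP; exact: ma.
- by move=> x _; rewrite lee_fin.
- by apply: integral_ge0 => q _; rewrite lee_fin.
Qed.

End integral_tens.

(** * Calculus and integration *)

Section calculus.
Context {R : realType}.

(** If [F2] were negative, [F1] would be negative just to the right of s, and the mean value theorem
    would push [F] below its minimum. Differentiability of [F1] at s alone is enough. *)
Lemma second_order_min (F F1 : R -> R) (s d F2 : R) : 0 < d ->
  (forall r, `|r - s| < d -> is_derive r 1 F (F1 r)) ->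
  is_derive s 1 F1 F2 -> (forall r, `|r - s| < d -> F s <= F r) ->
  F1 s = 0 /\ 0 <= F2.
Proof.
move=> d0 dF dF1 minF.
have ind r : r \in `](s - d), (s + d)[ -> `|r - s| < d.
  by rewrite in_itv /= -ltr_distl.
have F1s : F1 s = 0.
  have [|r rd||r /ind|_ <-] := @derive1_at_min R F (s - d) (s + d) s.
  - lra.
  - by have [] := dF r (ind _ rd).
  - by rewrite in_itv /=; apply/andP; split; lra.
  - exact: minF.
  - by have [|_ ->] := dF s; rewrite ?subrr ?normr0.
split=> //; rewrite leNgt; apply/negP => F20.
have [dv dE] := dF1.
have cv : (fun h => h^-1 *: ((F1 \o shift s) (h *: 1) - F1 s)) @ 0^' --> F2.
  by rewrite -dE.
have [e /= e0 He] : \forall h \near 0^', h^-1 *: ((F1 \o shift s) (h *: 1) - F1 s) < 0.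
  exact: (cvgr_lt _ cv).
(* [e] keeps the difference quotient of [F1] negative, [d] is the radius of the hypotheses on [F];
   halving makes both inequalities strict. *)
pose t := Order.min e d / 2.
have t0 : 0 < t by rewrite divr_gt0// lt_min e0 d0.
have te : t < e by rewrite /t; have := ge_min e e d; rewrite lexx /=; lra.
have td : t < d by rewrite /t; have := ge_min d e d; rewrite lexx orbT /=; lra.
have neg r : s < r <= s + t -> F1 r < 0.
  move=> /andP[sr rt]; have := He (r - s); rewrite /= F1s subr0 sub0r normrN.
  rewrite gtr0_norm ?subr_gt0// [_ *: 1]mulr1 subrK => /(_ _ _).
  rewrite /GRing.scale /= => H.
  have {}H : (r - s)^-1 * F1 r < 0 by apply: H; [lra|rewrite subr_eq0 gt_eqF].
  by move: H; rewrite pmulr_rlt0// invr_gt0 subr_gt0.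
have [|||c cst Fc] := @MVT R F F1 s (s + t).
- lra.
- move=> r; rewrite in_itv /= => /andP[sr rt]; apply: dF.
  by rewrite gtr0_norm; lra.
- apply: derivable_within_continuous => r; rewrite in_itv /= => /andP[sr rt].
  by have [] : is_derive r 1 F (F1 r) by apply: dF; rewrite ger0_norm; lra.
have : F s <= F (s + t) by apply: minF; rewrite gtr0_norm; lra.
move: cst; rewrite in_itv /= => /andP[sc ct].
have : F1 c < 0 by apply: neg; apply/andP; split; lra.
by move=> H; rewrite -subr_ge0 Fc; nra.
Qed.

(** The bound is required to the right of the smaller point, the shape in which the kernel bounds
    are available. *)
Lemma lipschitz_derive (F F1 : R -> R) (M a b : R) :
  (forall r, Order.min a b <= r -> is_derive r 1 F (F1 r) /\ `|F1 r| <= M) ->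
  `|F a - F b| <= M * `|a - b|.
Proof.
wlog ab : a b / a <= b => [H dF|].
  have [/H|/ltW/H] := leP a b; first exact.
  by rewrite distrC [`|b - a|]distrC minC; exact.
rewrite min_l// => dF.
have [||c cst Fc] := @MVT_segment R F F1 a b ab.
- by move=> r; rewrite in_itv /= => /andP[/ltW/dF[]].
- by apply: derivable_within_continuous => r; rewrite in_itv /= => /andP[/dF[[]]].
rewrite distrC Fc normrM [`|b - a|]distrC ler_wpM2r//.
by move: cst; rewrite in_itv /= => /andP[/dF[]].
Qed.

(** M >= 1 absorbs the factors that [P] discards. *)
Lemma norm_prod_le (I : Type) (r : seq I) (P : pred I) (a : I -> R) (M : R) :
  1 <= M -> (forall j, `|a j| <= M) -> `|\prod_(j <- r | P j) a j| <= M ^+ size r.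
Proof.
move=> M1 aM; elim: r => [|j r IH]; first by rewrite big_nil normr1.
rewrite big_cons /= exprS; case: ifP => _; first by rewrite normrM ler_pM.
by apply: le_trans IH _; rewrite ler_peMl// exprn_ge0//; lra.
Qed.

(** Telescoping: the factors are exchanged one at a time, the others being bounded by M. *)
Lemma prod_lipschitz (I : Type) (r : seq I) (a b : I -> R) (M : R) : 1 <= M ->
  (forall i, `|a i| <= M) -> (forall i, `|b i| <= M) ->
  `|\prod_(i <- r) a i - \prod_(i <- r) b i|
    <= M ^+ size r * \sum_(i <- r) `|a i - b i|.
Proof.
move=> M1 aM bM; have M0 : 0 <= M by lra.
elim: r => [|i r IH]; first by rewrite !big_nil subrr normr0 mulr0.
rewrite !big_cons /=.
set A := \prod_(j <- r) a j; set B := \prod_(j <- r) b j.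
have AM : `|A| <= M ^+ size r.
  rewrite /A; elim: (r) => [|j s IHs]; first by rewrite big_nil normr1.
  by rewrite big_cons normrM exprS ler_pM.
rewrite (_ : a i * A - b i * B = (a i - b i) * A + b i * (A - B)); last by ring.
apply: le_trans (ler_normD _ _) _; rewrite [leRHS]mulrDr !normrM; apply: lerD.
  rewrite mulrC ler_wpM2r//; apply: le_trans AM _.
  by rewrite exprS ler_peMl// exprn_ge0.
by rewrite exprS -mulrA ler_pM.
Qed.

End calculus.

Section integrals.
Context {R : realType} d {T : measurableType d} {mu : {measure set T -> \bar R}}.

Lemma integrable_bounded (D : set T) (w g : T -> R) (M : R) : measurable D ->
  mu.-integrable D (EFin \o w) -> measurable_fun D g ->
  (forall x, D x -> `|g x| <= M) -> mu.-integrable D (EFin \o (fun x => w x * g x)).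
Proof.
move=> mD iw mg gM.
have := @integrableMl _ _ _ mu D mD (EFin \o w) g iw mg; apply.
exists M; split; first exact: num_real.
by move=> x Mx y Dy; exact: le_trans (gM y Dy) (ltW Mx).
Qed.

(** Differentiation under the integral sign with dominating function |w| |M|. In the application [c]
    picks the coordinate being varied and [w] collects [u] with the remaining kernel factors. *)
Lemma is_derive_Rintegral (D : set T) (w c : T -> R) (A A1 : R -> R -> R)
    (lo hi M s : R) : measurable D ->
  mu.-integrable D (EFin \o w) -> measurable_fun setT c ->
  (forall r, measurable_fun setT (A r)) ->
  (forall r x, lo < r < hi -> [/\ is_derive r 1 (A ^~ x) (A1 r x),
     `|A r x| <= M & `|A1 r x| <= M]) ->
  lo < s < hi ->
  is_derive s 1 (fun r => \int[mu]_(q in D) (w q * A r (c q)))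
    (\int[mu]_(q in D) (w q * A1 s (c q))).
Proof.
move=> mD iw mc mA HA ls.
pose f r q := w q * A r (c q).
pose G q := `|w q| * `|M|.
have MM r x : lo < r < hi -> `|A r x| <= `|M| /\ `|A1 r x| <= `|M|.
  by move=> /HA-/(_ x)[_ H1 H2]; split; apply: le_trans (ler_norm M).
have E r q : lo < r < hi -> partial1of2 f r q = w q * A1 r (c q).
  move=> lr; have [H _ _] := HA r (c q) lr.
  by rewrite partial1of2E; have [_ ->] := is_deriveZ (w q) H.
have Is : [set` `]lo, hi[] s by rewrite /= in_itv.
have intf x : [set` `]lo, hi[] x -> mu.-integrable D (EFin \o f x).
  rewrite /= in_itv /= => lx.
  apply: integrable_bounded (fun q _ => (MM x (c q) lx).1) => //.
  apply: (@measurable_funS _ _ _ _ setT) => //.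
  exact: measurableT_comp (mA x) mc.
have df x y : [set` `]lo, hi[] x -> D y -> derivable (f ^~ y) x 1.
  rewrite /= in_itv /= => lx _; have [H _ _] := HA x (c y) lx.
  by have [] := is_deriveZ (w y) H.
have G0 y : 0 <= G y by rewrite mulr_ge0.
have iG : mu.-integrable D (EFin \o G).
  apply: (integrable_bounded (M := `|M|)) => //.
    exact: integrable_norm iw.
  by move=> x _; rewrite normr_id.
have Gub x y : [set` `]lo, hi[] x -> D y -> `|partial1of2 f x y| <= G y.
  rewrite /= in_itv /= => lx _; rewrite E// normrM ler_wpM2l//.
  by have [] := MM x (c y) lx.
apply: DeriveDef; first exact: (derivable_under_integral mD Is intf df G0 iG Gub).
rewrite -derive1E (differentiation_under_integral mD Is intf df G0 iG Gub).
by apply: eq_Rintegral => q _; exact: E.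
Qed.

End integrals.

(** * Mollification *)

Section mollification.
Context {R : realType} {m : nat}.
Variables (e : R) (D : set 'rV[R]_m.+1) (u : 'rV[R]_m.+1 -> R).
Hypotheses (e0 : 0 < e) (mD : measurable D).
Local Notation mu := (@lebesgue_rV R m.+1).
Hypothesis iu : mu.-integrable D (EFin \o u).
Implicit Types (y q : 'rV[R]_m.+1) (i j : 'I_m.+1).

Definition moll y j : R -> R := ker e (j == ord0) (y ord0 j).
Definition mollify y : R := \int[mu]_(q in D) (u q * tens (moll y) q).
Definition mollify1 i y : R :=
  \int[mu]_(q in D) (u q * tens (upd (moll y) i (ker1 e (i == ord0) (y ord0 i))) q).
Definition mollify2 i y : R :=
  \int[mu]_(q in D) (u q * tens (upd (moll y) i (ker2 e (i == ord0) (y ord0 i))) q).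

Lemma moll_bounded (l : R) : 0 < l -> exists2 M, 1 <= M &
  forall (rad : bool) (s x : R), (rad -> l <= s) ->
  [/\ `|ker e rad s x| <= M, `|ker1 e rad s x| <= M & `|ker2 e rad s x| <= M].
Proof.
move=> l0; have [M HM] := ker_bounded e0 l0.
exists (1 + `|M|) => [|rad s x ls]; first by rewrite lerDl.
have := ler_norm M; have [] := HM rad s x ls.
by move=> *; split; lra.
Qed.

Let measurable_ker rad s : measurable_fun setT (ker e rad s).
Proof. by apply: continuous_measurable_fun; exact: continuous_ker. Qed.

Let measurable_ker1 rad s : measurable_fun setT (ker1 e rad s).
Proof. by apply: continuous_measurable_fun; exact: continuous_ker1. Qed.

Let measurable_rest y i : measurable_fun D
  (fun q => \prod_(j < m.+1 | j != i) moll y j (q ord0 j)).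
Proof.
rewrite (_ : (fun _ => _) = tens (upd (moll y) i (fun=> 1))).
  apply: measurable_tens => j; rewrite /upd; case: ifP => // _.
  exact: measurable_ker.
by apply/funext => q; rewrite tens_updE mul1r.
Qed.

Let integrable_rest y i : 0 < y ord0 ord0 -> mu.-integrable D
  (EFin \o (fun q => u q * \prod_(j < m.+1 | j != i) moll y j (q ord0 j))).
Proof.
move=> y0; have [M M1 HM] := moll_bounded y0.
apply: integrable_bounded => //.
move=> q _; apply: (norm_prod_le _ _ M1) => j.
by have [] := HM (j == ord0) (y ord0 j) (q ord0 j) _; first by move/eqP ->.
Qed.

(** Isolates the only factor depending on the i-th coordinate of the centre, the form required by
    [is_derive_Rintegral]. *)
Lemma mollify_setc y i (r : R) :
  mollify (setc y i r) = \int[mu]_(q in D)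
    (u q * \prod_(j < m.+1 | j != i) moll y j (q ord0 j) *
     ker e (i == ord0) r (q ord0 i)).
Proof.
apply: eq_Rintegral => q _; rewrite -mulrA; congr (_ * _).
rewrite (tensD1 _ _ i) mulrC /moll setcE eqxx; congr (_ * _).
by apply: eq_bigr => j /negbTE ji; rewrite setcE ji.
Qed.

Lemma mollify1_setc y i (r : R) :
  mollify1 i (setc y i r) = \int[mu]_(q in D)
    (u q * \prod_(j < m.+1 | j != i) moll y j (q ord0 j) *
     ker1 e (i == ord0) r (q ord0 i)).
Proof.
apply: eq_Rintegral => q _; rewrite -mulrA; congr (_ * _).
rewrite tens_updE mulrC /moll setcE eqxx; congr (_ * _).
by apply: eq_bigr => j /negbTE ji; rewrite setcE ji.
Qed.

Lemma mollify2_setc y i (r : R) :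
  mollify2 i (setc y i r) = \int[mu]_(q in D)
    (u q * \prod_(j < m.+1 | j != i) moll y j (q ord0 j) *
     ker2 e (i == ord0) r (q ord0 i)).
Proof.
apply: eq_Rintegral => q _; rewrite -mulrA; congr (_ * _).
rewrite tens_updE mulrC /moll setcE eqxx; congr (_ * _).
by apply: eq_bigr => j /negbTE ji; rewrite setcE ji.
Qed.

(** An open window around r on which the kernel bounds are uniform: in the t direction it starts at
    r/2, so that it stays away from 0. *)
Let halfway (rad : bool) (r : R) : (rad -> 0 < r) -> exists2 l : R, 0 < l &
  exists lo hi, lo < r < hi /\ forall s, lo < s < hi -> rad -> l <= s.
Proof.
case: rad => [/(_ isT) r0|_].
  exists (r / 2); first lra.
  exists (r / 2), (r + 1); split; first by apply/andP; split; lra.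
  by move=> s /andP[/ltW].
by exists 1 => //; exists (r - 1), (r + 1); split=> //; apply/andP; split; lra.
Qed.

Lemma is_derive_mollify y i (r : R) : 0 < y ord0 ord0 -> (i == ord0 -> 0 < r) ->
  is_derive r 1 (fun r => mollify (setc y i r)) (mollify1 i (setc y i r)).
Proof.
move=> y0 /halfway[l l0 [lo [hi [lr Hl]]]]; have [M M1 HM] := moll_bounded l0.
rewrite mollify1_setc; under eq_fun do rewrite mollify_setc.
apply: (@is_derive_Rintegral _ _ _ _ D _ (fun q => q ord0 i) _ _ lo hi M) => //.
- exact: integrable_rest.
- exact: measurable_rV_coord.
- move=> s x ls; have [H0 H1 _] := HM (i == ord0) s x (Hl s ls).
  by split=> //; apply: is_derive_ker => // /(Hl s ls); exact: lt_le_trans.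
Qed.

Lemma is_derive_mollify1 y i (r : R) : 0 < y ord0 ord0 -> (i == ord0 -> 0 < r) ->
  is_derive r 1 (fun r => mollify1 i (setc y i r)) (mollify2 i (setc y i r)).
Proof.
move=> y0 /halfway[l l0 [lo [hi [lr Hl]]]]; have [M M1 HM] := moll_bounded l0.
rewrite mollify2_setc; under eq_fun do rewrite mollify1_setc.
apply: (@is_derive_Rintegral _ _ _ _ D _ (fun q => q ord0 i) _ _ lo hi M) => //.
- exact: integrable_rest.
- exact: measurable_rV_coord.
- move=> s x ls; have [_ H1 H2] := HM (i == ord0) s x (Hl s ls).
  by split=> //; apply: is_derive_ker1 => // /(Hl s ls); exact: lt_le_trans.
Qed.

Lemma integrable_moll y : 0 < y ord0 ord0 ->
  mu.-integrable D (EFin \o (fun q => u q * tens (moll y) q)).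
Proof.
move=> y0; have [M M1 HM] := moll_bounded y0.
apply: integrable_bounded => //.
  by apply: measurable_tens => j; exact: measurable_ker.
move=> q _; apply: (norm_prod_le _ _ M1) => j.
by have [] := HM (j == ord0) (y ord0 j) (q ord0 j) _; first by move/eqP ->.
Qed.

(** Joint continuity, needed for a minimum to exist on a compact box, does not follow from partial
    derivatives existing. It comes from a Lipschitz bound on the product kernel in its centre,
    integrated against |u|. *)
Lemma continuous_mollify y : 0 < y ord0 ord0 -> {for y, continuous mollify}.
Proof.
move=> y0; have [|M M1 HM] := @moll_bounded (y ord0 ord0 / 2); first lra.
pose I := \int[mu]_(q in D) `|u q|.
pose C := I * (M ^+ size (index_enum 'I_m.+1) * (m.+1%:R * M)).
have I0 : 0 <= I by apply: Rintegral_ge0.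
have C0 : 0 <= C by rewrite !mulr_ge0// ?exprn_ge0//; lra.
have lip z d : 0 < d -> ball y d z -> 0 < z ord0 ord0 ->
    y ord0 ord0 / 2 <= z ord0 ord0 ->
    `|mollify y - mollify z| <= C * d.
  move=> d0 /rV_ballP-/(_ d0) yz z0 yz0.
  have iy := integrable_moll y0; have iz := integrable_moll z0.
  have iB : mu.-integrable D
      (EFin \o (fun q => u q * tens (moll y) q - u q * tens (moll z) q)).
    by have H := integrableB mD iy iz; exact: H.
  rewrite /mollify -RintegralB//.
  apply: le_trans (le_normr_Rintegral mD iB) _.
  have -> : C * d = \int[mu]_(q in D)
      (`|u q| * (M ^+ size (index_enum 'I_m.+1) * (m.+1%:R * M) * d)).
    rewrite RintegralZr//; first by rewrite /C !mulrA.
    exact: integrable_norm.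
  apply: le_Rintegral => //.
  - exact: integrable_norm iB.
  - apply: (integrable_bounded
      (M := `|M ^+ size (index_enum 'I_m.+1) * (m.+1%:R * M) * d|)) => //.
    exact: integrable_norm.
  - move=> q _; rewrite -mulrBr normrM ler_wpM2l// -mulrA.
    apply: le_trans (prod_lipschitz _ M1 _ _) _.
    + move=> j; have [] := HM (j == ord0) (y ord0 j) (q ord0 j) _ => //.
      by move/eqP ->; lra.
    + move=> j; have [] := HM (j == ord0) (z ord0 j) (q ord0 j) _ => //.
      by move/eqP ->; lra.
    apply: ler_wpM2l; first by rewrite exprn_ge0//; lra.
    rewrite -mulrA -[m.+1 in leRHS]card_ord mulr_natl -sumr_const.
    apply: ler_sum => j _.
    have /le_trans : `|moll y j (q ord0 j) - moll z j (q ord0 j)|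
        <= M * `|y ord0 j - z ord0 j|.
      apply: (@lipschitz_derive _ (ker e (j == ord0) ^~ (q ord0 j))
        (ker1 e (j == ord0) ^~ (q ord0 j))) => r Hr.
      have lr : j == ord0 -> y ord0 ord0 / 2 <= r.
        by move/eqP => j0; apply: le_trans Hr; rewrite j0 le_min yz0 andbT; lra.
      split; last by have [] := HM (j == ord0) r (q ord0 j) lr.
      by apply: is_derive_ker => // /lr; apply: lt_le_trans; lra.
    by apply; rewrite ler_wpM2l ?ltW//; lra.
apply/(@cvgrPdist_le _ _ _ (nbhs y) (nbhs_filter y)) => eps eps0.
(* The second entry keeps t at least half its value at [y], where the constant [M] is valid; the 1
   in C + 1 guards against C = 0. *)
pose d := Order.min (eps / (C + 1)) (y ord0 ord0 / 2).
have d0 : 0 < d by rewrite lt_min !divr_gt0//; lra.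
have d1 : d <= eps / (C + 1) by rewrite ge_min lexx.
have d2 : d <= y ord0 ord0 / 2 by rewrite ge_min lexx orbT.
apply/nbhs_ballP; exists d => //= z yz.
have /(_ ord0) := (rV_ballP y z d0).1 yz; rewrite ltr_distlC => /andP[z1 z2].
apply: le_trans (lip z d d0 yz _ _) _; [lra..|].
move: d1; rewrite ler_pdivlMr; [nra|lra].
Qed.

(** When the kernel vanishes off [D] the integral extends to the whole space and factors into m + 1
    equal one-variable masses. *)
Lemma integral_moll : exists2 c : R, 0 < c & forall y, 0 < y ord0 ord0 ->
  (forall q, ~ D q -> tens (moll y) q = 0) ->
  \int[mu]_(q in D) tens (moll y) q = c.
Proof.
have [c c0 Hc] := integral_ker e0; exists (c ^+ m.+1); first exact: exprn_gt0.
move=> y y0 yD; rewrite Rintegral_mkcond /Rintegral.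
have pos j : j == ord0 -> 0 < y ord0 j by move/eqP ->.
have -> : (\int[mu]_x ((tens (moll y) \_ D) x)%:E = \int[mu]_x (tens (moll y) x)%:E)%E.
  apply: eq_integral => q _; congr EFin; rewrite patchE.
  by case: ifPn => //; rewrite notin_setE => /yD.
rewrite integral_tens; first last.
- by move=> j x; apply: ker_ge0 => //; exact: pos.
- by move=> j; exact: measurable_ker.
rewrite (eq_bigr (fun=> c%:E)); last by move=> j _; apply: Hc; exact: pos.
rewrite -[m.+1 in RHS]card_ord -prodr_const.
suff -> : (\prod_(j < m.+1) c%:E)%E = (\prod_(j < m.+1) c)%:E by [].
by elim/big_ind2 : _ => // x x' z z' -> ->.
Qed.

End mollification.

(** * The tested inequality *)

Section Rintegral_extra.
Context {R : realType} d {T : measurableType d} {mu : {measure set T -> \bar R}}.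

Lemma Rintegral_sub (C D : set T) (F : T -> R) : D `<=` C ->
  (forall q, ~ D q -> F q = 0) -> \int[mu]_(q in C) F q = \int[mu]_(q in D) F q.
Proof.
move=> DC F0; rewrite Rintegral_mkcond [RHS]Rintegral_mkcond.
apply: eq_Rintegral => q _; rewrite !patchE.
have [qD|qD] := boolP (q \in D).
  by rewrite ifT//; move: qD; rewrite !inE; exact: DC.
by case: ifP => // _; apply: F0; move: qD; rewrite notin_setE.
Qed.

Lemma Rintegral_sum (I : Type) (s : seq I) (D : set T) (F : I -> T -> R) :
  measurable D -> (forall i, mu.-integrable D (EFin \o F i)) ->
  mu.-integrable D (EFin \o (fun q => \sum_(i <- s) F i q)) /\
  \int[mu]_(q in D) (\sum_(i <- s) F i q) = \sum_(i <- s) \int[mu]_(q in D) F i q.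
Proof.
move=> mD iF; elim: s => [|i s [IH1 IH2]].
  rewrite big_nil; under eq_Rintegral do rewrite big_nil.
  split; last by rewrite Rintegral_cst// mul0r.
  by under eq_fun do rewrite big_nil; exact: integrable0.
rewrite big_cons -IH2 -RintegralD//; split; last first.
  by apply: eq_Rintegral => q _; rewrite big_cons.
by under eq_fun do rewrite big_cons; have H := integrableD mD (iF i) IH1; exact: H.
Qed.

End Rintegral_extra.

Section integrable_box.
Context {R : realType} {n : nat}.
Variables (l r : 'I_n -> R).
Local Notation D := (box l r).
Local Notation mu := (@lebesgue_rV R n).

Lemma continuous_box_bounded (w : 'rV[R]_n -> R) : {within D, continuous w} ->
  exists M, forall q, D q -> `|w q| <= M.
Proof.
move=> cw; have [q0|D0] := pselect (D !=set0); last first.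
  by exists 0 => q Dq; exfalso; apply: D0; exists q.
have [|c _ Hc] := @EVT_max_rV R n (fun q => `|w q|) D q0 (@box_compact _ _ l r).
  by move=> x; apply: cvg_norm; exact: cw.
by exists `|w c| => q Dq; apply: Hc; rewrite inE.
Qed.

Lemma integrable_box_tens (w : 'rV[R]_n -> R) (a : 'I_n -> R -> R) :
  mu.-integrable D (EFin \o w) -> (forall j, continuous (a j)) ->
  mu.-integrable D (EFin \o (fun q => w q * tens a q)).
Proof.
move=> iw ca; have [|M HM] := @continuous_box_bounded (tens a).
  exact/continuous_subspaceT/continuous_tens.
apply: integrable_bounded HM => //; first exact: measurable_box.
by apply: measurable_tens => j; exact: continuous_measurable_fun.
Qed.

Lemma integrable_box_continuous (O : set 'rV[R]_n) (w : 'rV[R]_n -> R) :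
  open O -> D `<=` O -> {within O, continuous w} -> mu.-integrable D (EFin \o w).
Proof.
move=> oO DO cw; have [|M HM] := @continuous_box_bounded w.
  exact: continuous_subspaceW cw.
apply: measurable_bounded_integrable.
- exact: measurable_box.
- exact: box_fin.
- apply: (@measurable_funS _ _ _ _ O) => //; first exact: open_measurable_rV.
  exact: continuous_measurable_rV.
- exists M; split; first exact: num_real.
  by move=> x Mx q Dq; apply: le_trans (HM q Dq) (ltW Mx).
Qed.

Lemma integrable_box_L1_loc (O : set 'rV[R]_n) (w : 'rV[R]_n -> R) :
  open O -> D `<=` O -> L1_loc O w -> mu.-integrable D (EFin \o w).
Proof.
move=> oO DO [mw iw]; apply/integrableP; split.
  apply/measurable_EFinP; apply: (@measurable_funS _ _ _ _ O) => //.
  exact: open_measurable_rV.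
exact: iw (@box_compact _ _ l r) DO.
Qed.

End integrable_box.

Section upd.
Context {R : realType} {n : nat}.
Implicit Types (a : 'I_n -> R -> R) (i : 'I_n).

Lemma upd_upd a i g g' : upd (upd a i g) i g' = upd a i g'.
Proof. by apply/funext => j; rewrite /upd; case: eqP. Qed.

Lemma updE a i g : upd a i g i = g.
Proof. by rewrite /upd eqxx. Qed.

Lemma partial_tens_upd a i g : (forall j, line_smooth (a j)) -> line_smooth g ->
  partial i (tens (upd a i g)) = tens (upd a i (derive1 g)).
Proof.
move=> sa sg; rewrite partial_tens ?updE ?upd_upd//.
exact: line_smooth_upd.
Qed.

End upd.

Section weak_inequality.
Context {R : realType} {m : nat}.
Variables (X : set 'rV[R]_m) (gamma : R) (h : R -> R) (f u : 'rV[R]_m.+1 -> R).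
Hypotheses (oC : open (cone X)) (ch : continuous h).
Hypotheses (cf : {within cone X, continuous f}) (cu : {within cone X, continuous u}).
Hypothesis su : weak_supersolution X gamma h f u.
Variables (e : R) (l r : 'I_m.+1 -> R).
Hypotheses (e0 : 0 < e) (DC : box l r `<=` cone X).
Local Notation D := (box l r).
Local Notation mu := (@lebesgue_rV R m.+1).
Implicit Types (y q : 'rV[R]_m.+1) (i j : 'I_m.+1).

Let v i := weak_partial (cone X) i u.

Let Hv i : is_weak_partial (cone X) i u (v i).
Proof.
have [[_ /(_ i)[[w Hw] _]] _ _] := su.
exact: (@xgetPex _ (cst 0) [set v | is_weak_partial (cone X) i u v]) (ex_intro _ w Hw).
Qed.

Let mD : measurable D := measurable_box l r.

Let iv i : mu.-integrable D (EFin \o v i).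
Proof. by have [_ H _] := Hv i; exact: integrable_box_L1_loc H. Qed.

Let g q := f q - h (u q).

Let ig : mu.-integrable D (EFin \o g).
Proof.
apply: (integrable_box_continuous oC DC).
move=> x; apply: cvgB; first exact: cf.
apply: (continuous_comp (f := (u : subspace (cone X) -> R))); first exact: cu.
exact: ch.
Qed.

Variable y : 'rV[R]_m.+1.
Hypotheses (y0 : 0 < y ord0 ord0 <= 1).
Hypothesis yD : forall j, l j <= y ord0 j - e /\ y ord0 j + e <= r j.

Let a := moll e y.
Let ypos j : j == ord0 -> 0 < y ord0 j <= 1.
Proof. by move/eqP ->. Qed.

Let sa j : line_smooth (a j).
Proof. exact: line_smooth_ker. Qed.

Let a_out j x : x \notin `[l j, r j] -> a j x = 0.
Proof.
move=> xlr; apply: (ker_out e0 (ypos (j := j))).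
apply: contra xlr; rewrite !in_itv /= => /andP[H1 H2].
by have [? ?] := yD j; apply/andP; split; lra.
Qed.

Let upd_out i (b : R -> R) : (forall x, x \notin `[l i, r i] -> b x = 0) ->
  forall j x, x \notin `[l j, r j] -> upd a i b j x = 0.
Proof.
move=> b0 j x; rewrite /upd; case: eqP => [->|_]; [exact: b0|exact: a_out].
Qed.

Let a0' := derive1 (a ord0).

(* For i = 0 this is t^-1 (t^3 a)' - (m + 1) t a: the gradient term minus the
   first order term of the weak formulation. *)
Let pfun i : R -> R := if i == ord0
  then fun t => t ^+ 2 * a0' t + (2 - m%:R) * (t * a ord0 t) else derive1 (a i).

Let sp i : line_smooth (pfun i).
Proof.
rewrite /pfun; case: ifP => _; last exact: line_smooth_derive1.
apply: line_smoothD; apply: line_smoothM.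
- exact: line_smoothX.
- exact: line_smooth_derive1.
- exact: line_smooth_cst.
- by apply: line_smoothM => //; exact: line_smooth_id.
Qed.

Let p_out i x : x \notin `[l i, r i] -> pfun i x = 0.
Proof.
move=> xlr; have a0 : derive1 (a i) x = 0 by apply: derive1_out xlr => x'; exact: a_out.
rewrite /pfun; case: eqP => // i0; move: xlr a0; rewrite i0 => xlr a0.
by rewrite /a0' a0 a_out// !mulr0 addr0.
Qed.

(** The definition of the weak derivative, tested with a tensor product supported in the box; both
    integrals are then restricted from the cone to the box. *)
Let parts i : \int[mu]_(q in D) (v i q * tens (upd a i (pfun i)) q) =
  - \int[mu]_(q in D) (u q * tens (upd a i (derive1 (pfun i))) q).
Proof.
have [_ _ /(_ (tens (upd a i (pfun i))))] := Hv i.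
rewrite partial_tens_upd// => H.
rewrite -(@Rintegral_sub _ _ _ _ (cone X)) => //; last first.
  by move=> q nDq; rewrite (tens_out (upd_out (@p_out i)) nDq) mulr0.
rewrite -[X in _ = - X](@Rintegral_sub _ _ _ _ (cone X)) => //; last first.
  move=> q nDq; rewrite (tens_out (upd_out _) nDq) ?mulr0//.
  by move=> x; apply: derive1_out => x'; exact: p_out.
apply/eqP; rewrite -eqr_oppLR; apply/eqP; rewrite H ?opprK//.
apply: test_function_tens DC; last exact/upd_out/p_out.
exact: line_smooth_upd.
Qed.

Let t1 (t : R) : R := t * a ord0 t.
Let t2 (t : R) : R := t ^+ 2 * a ord0 t.
Let t3 (t : R) : R := t ^+ 3 * a ord0 t.

Let st3 : line_smooth t3.
Proof. by apply: line_smoothM => //; exact: line_smoothX. Qed.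

Let ct1 : continuous t1.
Proof.
apply: line_smooth_continuous; apply: line_smoothM => //; exact: line_smooth_id.
Qed.

Let ct2 : continuous t2.
Proof.
apply: line_smooth_continuous; apply: line_smoothM => //; exact: line_smoothX.
Qed.

Let cupd i b : continuous b -> forall j, continuous (upd a i b j).
Proof.
move=> cb j; rewrite /upd; case: ifP => // _; exact: line_smooth_continuous.
Qed.

Let t3_out x : x \notin `[l ord0, r ord0] -> t3 x = 0.
Proof. by move=> /a_out; rewrite /t3 => ->; rewrite mulr0. Qed.

Let derive1_t3 t : derive1 t3 t = 3 * t ^+ 2 * a ord0 t + t ^+ 3 * a0' t.
Proof.
have dX := @is_deriveX _ _ id 3 t 1 1 (is_derive_id _ _).
have da : is_derive t 1 (a ord0) (a0' t).
  by rewrite /a0' derive1E; apply: DeriveDef => //; exact: line_smooth_derivable.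
rewrite derive1E (_ : t3 = id ^+ 3 * a ord0); last first.
  by apply/funext => x; rewrite /t3 exprfctE fctE.
have [_ ->] := is_deriveM dX da; rewrite /GRing.scale /= exprfctE.
by ring.
Qed.

(* The factor t^3 cancels the weight t^-2 and the density 1/t. *)
Let psi := tens (upd a ord0 t3).

Let test_psi : test_function (cone X) psi.
Proof.
apply: test_function_tens DC; last exact/upd_out/t3_out.
exact: line_smooth_upd.
Qed.

Let psi_ge0 q : 0 <= psi q.
Proof.
have [Dq|nDq] := pselect (D q); last first.
  by rewrite /psi (tens_out (upd_out t3_out) nDq).
have [/andP[t0 _] _] := DC Dq.
have a_ge0 j x : 0 <= a j x by apply: ker_ge0 => // /ypos/andP[].
apply: prodr_ge0 => j _; rewrite /upd; case: (j =P ord0) => [->|_] //.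
by rewrite mulr_ge0// exprn_ge0// ltW.
Qed.

Let partial_psi i q : i != ord0 ->
  partial i psi q = q ord0 ord0 ^+ 3 * tens (upd a i (derive1 (a i))) q.
Proof.
move=> i0; rewrite /psi partial_tens; last exact: line_smooth_upd.
have -> : upd a ord0 t3 i = a i by rewrite /upd (negbTE i0).
have -> : upd (upd a ord0 t3) i (derive1 (a i)) = upd (upd a i (derive1 (a i))) ord0 t3.
  apply/funext => j; rewrite /upd; case: eqP => [->|//].
  by rewrite (negbTE i0).
rewrite tens_updE (tensD1 _ _ ord0) /t3 mulrA; congr (_ * _ * _).
by rewrite /upd eq_sym (negbTE i0).
Qed.

(** The first order term of the weak formulation is kept in [lhs] and added in [rhs] as the same
    summand, so that it cancels and only the weak derivatives paired with [pfun] remain. *)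
Let lhs q := - g q * tens (upd a ord0 t2) q +
  v ord0 q * (m.+1%:R * tens (upd a ord0 t1) q).
Let rhs q := \sum_i v i q * tens (upd a i (pfun i)) q +
  v ord0 q * (m.+1%:R * tens (upd a ord0 t1) q).

Let lhsE : \int[mu]_(p in cone X)
  ((- f p + h (u p) + m.+1%:R * (tc p) ^- 2 * weak_cone_D X ord0 u p) * psi p / tc p)
  = \int[mu]_(q in D) lhs q.
Proof.
rewrite (Rintegral_sub DC); last first.
  by move=> q nDq; rewrite /psi (tens_out (upd_out t3_out) nDq) mulr0 mul0r.
apply: eq_Rintegral => q; rewrite inE => Dq.
have [/andP[t0 _] _] := DC Dq.
rewrite /lhs /psi !tens_updE /weak_cone_D /cone_coef eqxx /g /t1 /t2 /t3 -/(v ord0).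
move: t0; rewrite /tc; move: (q ord0 ord0) => t t0.
by field; rewrite gt_eqF.
Qed.

Let rhsE : \int[mu]_(p in cone X)
  ((tc p) ^- 2 * (\sum_i weak_cone_D X i u p * cone_D i psi p) / tc p)
  = \int[mu]_(q in D) rhs q.
Proof.
rewrite (Rintegral_sub DC); last first.
  move=> q nDq; rewrite big1 ?mulr0 ?mul0r// => i _.
  rewrite /cone_D /psi partial_tens; last exact: line_smooth_upd.
  rewrite [X in _ * (_ * X)](tens_out _ nDq) ?mulr0// => j x xlr.
  rewrite {1}/upd; case: eqP => [ji|_]; last exact: (upd_out t3_out).
  rewrite -ji; apply: derive1_out xlr => x'; exact: (upd_out t3_out).
apply: eq_Rintegral => q; rewrite inE => Dq.
have [/andP[t0 _] _] := DC Dq.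
rewrite /rhs big_ord_recl [X in _ = X + _]big_ord_recl mulrDr mulrDl.
rewrite addrAC; congr (_ + _); last first.
  rewrite mulr_sumr mulr_suml; apply: eq_bigr => i _.
  rewrite /weak_cone_D /cone_D /cone_coef /= partial_psi// /pfun /=.
  move: t0; rewrite /tc; move: (q ord0 ord0) => t t0; rewrite -/(v _).
  by field; rewrite gt_eqF.
rewrite /cone_D /psi partial_tens_upd// !tens_updE derive1_t3.
rewrite /weak_cone_D /cone_coef eqxx /pfun eqxx -/(v ord0) /t1 -natr1.
move: t0; rewrite /tc; move: (q ord0 ord0) => t t0.
by field; rewrite gt_eqF.
Qed.

(** After [parts], the derivatives act on the kernel in the integration variable q; [ker_adjoint]
    and [derive2_ker_false] exchange them for derivatives in the centre y, which are those of the
    mollification. The inequality carries the factor t^2, whence q_0^2 on the right. *)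
Lemma weak_supersolution_mollify :
  y ord0 ord0 ^+ 2 * mollify2 e D u ord0 y
  + m%:R * (y ord0 ord0 * mollify1 e D u ord0 y)
  + \sum_(i < m) mollify2 e D u (lift ord0 i) y
  <= \int[mu]_(q in D) (q ord0 ord0 ^+ 2 * (f q - h (u q)) * tens (moll e y) q).
Proof.
have ig2 : mu.-integrable D (EFin \o (fun q => - g q * tens (upd a ord0 t2) q)).
  apply: integrable_box_tens; last exact: cupd.
  by have H := integrableN ig; exact: H.
have iv1 : mu.-integrable D
    (EFin \o (fun q => v ord0 q * (m.+1%:R * tens (upd a ord0 t1) q))).
  under eq_fun do rewrite mulrA [_ * m.+1%:R]mulrC -mulrA.
  have H := integrableZl mD m.+1%:R (integrable_box_tens (iv ord0) (cupd ct1)).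
  exact: H.
have [|iS intS] := @Rintegral_sum _ _ _ mu _ (index_enum 'I_m.+1) D
  (fun i q => v i q * tens (upd a i (pfun i)) q) mD.
  move=> i; apply: integrable_box_tens => //; apply: cupd.
  exact: line_smooth_continuous.
have [_ _ /(_ _ test_psi psi_ge0)] := su; rewrite lhsE rhsE /lhs /rhs.
rewrite (RintegralD mD ig2 iv1) (RintegralD mD iS iv1) lerD2r intS.
rewrite (eq_bigr _ (fun i _ => parts i)) sumrN -lerN2 opprK.
rewrite big_ord_recl => H.
have int_u j b : continuous b ->
    mu.-integrable D (EFin \o (fun q => u q * tens (upd a j b) q)).
  move=> cb; apply: integrable_box_tens; last exact: cupd.
  exact: integrable_box_continuous cu.
have y00 : 0 < y ord0 ord0 by case/andP: y0.
(* This is [ker_adjoint] with N = m, integrated against [u] and the other factors. *)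
have E0 : \int[mu]_(q in D) (u q * tens (upd a ord0 (derive1 (pfun ord0))) q) =
    y ord0 ord0 ^+ 2 * mollify2 e D u ord0 y
    + m%:R * (y ord0 ord0 * mollify1 e D u ord0 y).
  have ik2 := int_u ord0 _ (@continuous_ker2 _ _ e0 true (y ord0 ord0)).
  have ik1 := int_u ord0 _ (@continuous_ker1 _ _ e0 true (y ord0 ord0)).
  rewrite /mollify2 /mollify1 mulrA -!RintegralZl// -RintegralD//; first last.
  - by have K := integrableZl mD (m%:R * y ord0 ord0) ik1; exact: K.
  - by have K := integrableZl mD (y ord0 ord0 ^+ 2) ik2; exact: K.
  apply: eq_Rintegral => q _; rewrite !tens_updE.
  rewrite /pfun eqxx /a0' /a /moll eqxx ker_adjoint//.
  by ring.
have Ei i : i != ord0 ->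
    \int[mu]_(q in D) (u q * tens (upd a i (derive1 (pfun i))) q) = mollify2 e D u i y.
  move=> /negbTE i0; rewrite /pfun i0 /mollify2; apply: eq_Rintegral => q _.
  by rewrite !tens_updE /a /moll i0 derive2_ker_false.
have {}H := le_trans (eq_ind _ (fun s => s <= _) H _ _).
apply: H.
  refine (f_equal2 +%R E0 _).
  apply: eq_bigr => i _.
  exact: Ei.
rewrite -[leLHS]mulN1r -RintegralZl//.
under eq_Rintegral => q _.
  rewrite mulN1r mulNr opprK tens_updE /t2.
  over.
rewrite le_eqVlt; apply/orP; left; apply/eqP; apply: eq_Rintegral => q _.
by rewrite (tensD1 _ _ ord0) /g /a; ring.
Qed.

End weak_inequality.

(** * Touching from below *)

Section uniform.
Context {R : realType} {n : nat}.

(** Only [y] is confined to [D]; [q] ranges over a full ball. The near-covering form of compactness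
    is applied with the radius tending to 0 from the right as parameter. *)
Lemma compact_unif_continuous (D : set 'rV[R]_n) (u : 'rV[R]_n -> R) (delta : R) :
  compact D -> (forall x, D x -> {for x, continuous u}) -> 0 < delta ->
  exists2 e, 0 < e & forall y q, D y -> ball y e q -> `|u q - u y| <= delta.
Proof.
move=> /compact_near_coveringP cD cu d0.
have H := cD _ (0^'+ : set_system R)
  (fun e y => forall q, ball y e q -> `|u q - u y| <= delta) _.
have {}H : \forall e \near 0^'+,
    D `<=` (fun y => forall q, ball y e q -> `|u q - u y| <= delta).
  apply: H => x Dx.
  have d20 : 0 < delta / 2 by lra.
  have := (@cvgrPdist_lt _ _ _ (nbhs x) (nbhs_filter x) u (u x)).1 (cu x Dx) _ d20.
  move=> /nbhs_ballP[rho /= rho0 Hr].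
  have rho20 : 0 < rho / 2 by lra.
  (* Two half radii: by the triangle inequality [y] and [q] both fall in the ball of radius rho
     around [x]. *)
  exists (ball x (rho / 2), [set e | e < rho / 2]); first split => /=.
  - exact: nbhsx_ballx.
  - exact: nbhs_right_lt.
  - move=> [y e] /= [xy er] q yq.
    have := Hr y (le_ball _ xy); have := Hr q _ => /= Hq Hy.
    have {}Hq : `|u x - u q| < delta / 2.
      apply: Hq; rewrite (splitr rho); apply: ball_triangle xy _.
      exact: le_ball (ltW er) _ yq.
    have {}Hy : `|u x - u y| < delta / 2 by apply: Hy; lra.
    rewrite (_ : u q - u y = - (u x - u q) + (u x - u y)); last by ring.
    by apply: le_trans (ler_normD _ _) _; rewrite normrN; lra.
have [e [He e0]] := filter_ex (filterI H (nbhs_right_gt (0 : R))).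
by exists e => // y q Dy; exact: He.
Qed.

Lemma box_ballP (p q : 'rV[R]_n) (r : R) :
  box (fun j => p ord0 j - r) (fun j => p ord0 j + r) q <->
  forall j, `|q ord0 j - p ord0 j| <= r.
Proof.
by split=> H j; have := H j; rewrite /= in_itv /= -ler_distl.
Qed.

End uniform.

Section cone_geometry.
Context {R : realType} {m : nat}.
Implicit Types (p q : 'rV[R]_m.+1).

Lemma open_cone (X : set 'rV[R]_m) : open X -> open (cone X).
Proof.
move=> oX; rewrite openE => p [/andP[t0 t1] Xp].
have /nbhs_ballP[d /= d0 dX] : nbhs (xc p) X by exact: open_nbhs_nbhs.
pose d' := Order.min d (Order.min (tc p) (1 - tc p)).
have d'0 : 0 < d' by rewrite !lt_min d0 t0 /=; lra.
have [d1 d2 d3] : [/\ d' <= d, d' <= tc p & d' <= 1 - tc p].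
  by split; rewrite /d' !ge_min ?lexx ?orbT.
apply/nbhs_ballP; exists d' => //= q /rV_ballP-/(_ d'0) pq; split.
  have := pq ord0; rewrite -/(tc p) -/(tc q) ltr_distlC => /andP[? ?].
  by apply/andP; split; lra.
apply: dX; apply/rV_ballP => // j; rewrite !mxE.
exact: lt_le_trans (pq _) d1.
Qed.

Lemma is_derive_coord (i : 'I_m.+1) p :
  is_derive p (delta_mx ord0 i) (fun q => q ord0 i) (1 : R).
Proof.
rewrite -{1}(setc_id p i); apply/is_derive_setc.
rewrite (_ : (fun r => _) = id); first exact: is_derive_id.
by apply/funext => r; rewrite setcE eqxx.
Qed.

Lemma Ck2P (O : set 'rV[R]_m.+1) (phi : 'rV[R]_m.+1 -> R) : open O -> Ck 2 O phi ->
  (forall x, O x -> {for x, continuous phi}) /\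
  forall i x, O x -> [/\ derivable phi x (delta_mx ord0 i),
     derivable (partial i phi) x (delta_mx ord0 i),
     {for x, continuous (partial i phi)} &
     {for x, continuous (partial i (partial i phi))}].
Proof.
move=> oO [c0 H].
have cO (f : 'rV[R]_m.+1 -> R) : {within O, continuous f} ->
    forall x, O x -> {for x, continuous f}.
  by rewrite continuous_open_subspace// => cf x Ox; apply: cf; rewrite inE.
split=> [|i x Ox]; first exact: cO.
have [d1 [c1 /(_ i)[d2 [c2 _]]]] := H i.
by split; [exact: d1|exact: d2|exact: cO c1 _ Ox|exact: cO c2 _ Ox].
Qed.

Lemma cone_operatorE (X : set 'rV[R]_m) (phi : 'rV[R]_m.+1 -> R) p :
  open (cone X) -> Ck 2 (cone X) phi -> cone X p ->
  cone_laplacian phi p + (m.+1%:R - 2) * cone_D ord0 phi p =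
  tc p ^+ 2 * partial ord0 (partial ord0 phi) p + m%:R * (tc p * partial ord0 phi p)
  + \sum_(i < m) partial (lift ord0 i) (partial (lift ord0 i) phi) p.
Proof.
move=> oC Cphi Cp; have [_ dphi] := Ck2P oC Cphi.
have E0 : cone_D ord0 (cone_D ord0 phi) p =
    tc p * (partial ord0 phi p + tc p * partial ord0 (partial ord0 phi) p).
  rewrite {1}/cone_D /cone_coef eqxx; congr (_ * _).
  have [_ d2 _ _] := dphi ord0 p Cp.
  have D := is_deriveM (is_derive_coord ord0 p) (DeriveDef d2 erefl).
  rewrite /partial (_ : cone_D ord0 phi = (fun q => q ord0 ord0) * partial ord0 phi).
    by have [_ ->] := D; rewrite /GRing.scale /= mulr1 addrC.
  by apply/funext => q; rewrite /cone_D /cone_coef eqxx.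
have Ei (i : 'I_m) : cone_D (lift ord0 i) (cone_D (lift ord0 i) phi) p =
    partial (lift ord0 i) (partial (lift ord0 i) phi) p.
  have CE f : cone_D (lift ord0 i) f = partial (lift ord0 i) f.
    by apply/funext => q; rewrite /cone_D /cone_coef /= mul1r.
  by rewrite !CE.
rewrite /cone_laplacian E0 (eq_bigr _ (fun i _ => Ei i)) /cone_D /cone_coef eqxx.
by rewrite -natr1; ring.
Qed.

End cone_geometry.

Section moll_average.
Context {R : realType} {m : nat}.
Variables (e : R) (l r : 'I_m.+1 -> R).
Hypothesis e0 : 0 < e.
Local Notation D := (box l r).
Local Notation mu := (@lebesgue_rV R m.+1).
Implicit Types (y q : 'rV[R]_m.+1).

Lemma moll_ge0 y q : 0 < y ord0 ord0 -> 0 <= tens (moll e y) q.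
Proof. by move=> y0; apply: prodr_ge0 => j _; apply: ker_ge0 => // /eqP ->. Qed.

Lemma moll_out y q : 0 < y ord0 ord0 <= 1 ->
  ~ (forall j, `|q ord0 j - y ord0 j| <= e) -> tens (moll e y) q = 0.
Proof.
move=> y0 yq; apply: (@tens_out _ _ _ (fun j => y ord0 j - e) (fun j => y ord0 j + e)).
  by move=> j x; apply: ker_out => // /eqP ->.
by move=> /box_ballP.
Qed.

(** The kernel is nonnegative and sees only points within [e] of [y]. Used for [u], for -u (giving
    lower bounds) and for the right-hand side [G]. *)
Lemma Rintegral_moll_le y (g : 'rV[R]_m.+1 -> R) (A : R) :
  mu.-integrable D (EFin \o g) -> 0 < y ord0 ord0 <= 1 ->
  (forall q, D q -> (forall j, `|q ord0 j - y ord0 j| <= e) -> g q <= A) ->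
  \int[mu]_(q in D) (g q * tens (moll e y) q)
    <= A * \int[mu]_(q in D) tens (moll e y) q.
Proof.
move=> ig y01 gA; have /andP[y0 _] := y01.
have mD : measurable D by exact: measurable_box.
have i1 (B : R) : mu.-integrable D (EFin \o (fun=> B)).
  apply: (integrable_box_continuous openT) => //.
  by apply: continuous_subspaceT => x; exact: cst_continuous.
have ik : mu.-integrable D (EFin \o tens (moll e y)).
  have := integrable_moll e0 mD (i1 1) y0.
  by under eq_fun do rewrite mul1r.
rewrite -RintegralZl//; apply: le_Rintegral => //.
- exact: integrable_moll.
- exact: integrable_moll.
- move=> q Dq; have [yq|yq] := pselect (forall j, `|q ord0 j - y ord0 j| <= e).
    by apply: ler_wpM2r; [exact: moll_ge0|exact: gA].
  by rewrite (moll_out y01 yq) !mulr0.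
Qed.

End moll_average.

Lemma is_derive_sqr_dist {R : realType} {n : nat} (y p : 'rV[R]_n) (i : 'I_n) (s : R) :
  is_derive s 1 (fun s => \sum_j (setc y i s ord0 j - p ord0 j) ^+ 2)
    (2 * (s - p ord0 i)).
Proof.
have E r : \sum_j (setc y i r ord0 j - p ord0 j) ^+ 2 =
    (1 * r + - p ord0 i) ^+ 2 + \sum_(j < n | j != i) (y ord0 j - p ord0 j) ^+ 2.
  rewrite (bigD1 i)//= setcE eqxx mul1r; congr (_ + _).
  by apply: eq_bigr => j /negbTE ji; rewrite setcE ji.
under eq_fun do rewrite E.
have d1 := is_derive_affine 1 (- p ord0 i) s.
have d2 := @is_deriveX _ _ (fun r : R => 1 * r + - p ord0 i) 2 s 1 1 d1.
have d3 := is_deriveD d2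
  (is_derive_cst (\sum_(j < n | j != i) (y ord0 j - p ord0 j) ^+ 2) s 1).
apply: is_derive_eq d3 _; rewrite addr0 /GRing.scale /= !mulr1 mul1r.
by [].
Qed.

(** Excludes a minimum on the boundary of the small box: there the penalty gains at least c k r2,
    while the mollification errors at [y] and [p] cost c k r2 / 4 each. *)
Lemma boundary_contradiction {R : realType} (c k r2 Wy Wp Sy uy up fy fp d : R) :
  0 < c -> 0 < k -> 0 < r2 -> up - fp <= uy - fy -> r2 <= Sy -> d = k * r2 / 4 ->
  (uy - d) * c <= Wy -> Wp <= (up + d) * c ->
  Wy - c * fy + c * k * Sy <= Wp - c * fp -> False.
Proof.
move=> c0 k0 r0 H1 H2 H3 H4 H5 H6.
have P1 : c * (up - fp) <= c * (uy - fy) by rewrite ler_pM2l.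
have P2 : c * k * r2 <= c * k * Sy by rewrite ler_pM2l// mulr_gt0.
have P3 : 0 < c * k * r2 by rewrite !mulr_gt0.
have P4 : d * c = c * k * r2 / 4 by rewrite H3; ring.
lra.
Qed.

(** Error budget at the interior minimum, with margin 4 eta: one eta for the variation of the
    operator on [phi], one for that of the right-hand side, one for the penalty. The penalty costs
    at most k (2 + 2 M + 2 M), because t^2 and t (t - s) are at most 1. *)
Lemma touching_contradiction {R : realType} (c k M t s A B C D2 E g L eta : R) :
  0 < c -> 0 < k -> 0 <= M -> 0 < t <= 1 -> 0 < s -> k * (2 + 4 * M) = eta ->
  c * A - c * k * 2 <= D2 -> c * C - c * k * 2 * M <= E ->
  t ^+ 2 * D2 + M * (t * (c * B - c * k * (2 * (t - s)))) + E <= (g + eta) * c ->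
  L - eta < t ^+ 2 * A + M * (t * B) + C -> L - g = 4 * eta -> 0 < eta -> False.
Proof.
move=> c0 k0 M0 /andP[t0 t1] s0 keta H1 H2 H3 H4 H5 eta0.
have ck0 : 0 < c * k by exact: mulr_gt0.
have tt : t ^+ 2 <= 1 by rewrite expr2; nra.
have t2 : 0 < t ^+ 2 by exact: exprn_gt0.
have P1 : t ^+ 2 * (c * A - c * k * 2) <= t ^+ 2 * D2 by rewrite ler_pM2l.
have P2 : t ^+ 2 * (c * k * 2) <= 1 * (c * k * 2) by rewrite ler_pM2r// mulr_gt0.
have P3 : M * (t * (t - s)) <= M * 1 by rewrite ler_wpM2l//; nra.
have P4 : (c * k * 2) * (M * (t * (t - s))) <= (c * k * 2) * (M * 1).
  by rewrite ler_pM2l// mulr_gt0.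
have P5 : c * (L - eta) < c * (t ^+ 2 * A + M * (t * B) + C) by rewrite ltr_pM2l.
have P6 : c * (L - g) = c * (4 * eta) by rewrite H5.
have P7 : c * (k * (2 + 4 * M)) = c * eta by rewrite keta.
have P8 : 0 < c * eta by exact: mulr_gt0.
lra.
Qed.

(** * The viscosity inequality at a touching point, multiplied by t^2 *)

Section viscosity.
Context {R : realType} {m : nat}.
Variables (X : set 'rV[R]_m) (gamma : R) (h : R -> R) (f u : 'rV[R]_m.+1 -> R).
Hypotheses (oC : open (cone X)) (ch : continuous h).
Hypotheses (cf : {within cone X, continuous f}) (cu : {within cone X, continuous u}).
Hypothesis su : weak_supersolution X gamma h f u.
Variables (phi : 'rV[R]_m.+1 -> R) (p : 'rV[R]_m.+1).
Hypotheses (Cphi : Ck 2 (cone X) phi) (Cp : cone X p).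
Local Notation mu := (@lebesgue_rV R m.+1).

Let Lam (q : 'rV[R]_m.+1) : R :=
  tc q ^+ 2 * partial ord0 (partial ord0 phi) q + m%:R * (tc q * partial ord0 phi q)
  + \sum_(i < m) partial (lift ord0 i) (partial (lift ord0 i) phi) q.

Let G (q : 'rV[R]_m.+1) : R := tc q ^+ 2 * (f q - h (u q)).

Let cont (w : 'rV[R]_m.+1 -> R) : {within cone X, continuous w} ->
  forall x, cone X x -> {for x, continuous w}.
Proof. by rewrite continuous_open_subspace// => cw x Cx; apply: cw; rewrite inE. Qed.

Let ctc x : {for x, continuous (@tc R m)}.
Proof. exact: coord_continuous. Qed.

Let ctc2 x : {for x, continuous (fun q => @tc R m q ^+ 2)}.
Proof.
apply: (continuous_comp (f := @tc R m) (g := fun t : R => t ^+ 2)).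
  exact: ctc.
exact: exprn_continuous.
Qed.

Let cLam : {for p, continuous Lam}.
Proof.
have [_ dphi] := Ck2P oC Cphi.
have cA : {for p, continuous
    (fun q => tc q ^+ 2 * partial ord0 (partial ord0 phi) q)}.
  by apply: continuousM; [exact: ctc2|have [] := dphi ord0 p Cp].
have cB : {for p, continuous (fun q => m%:R * (tc q * partial ord0 phi q))}.
  apply: continuousM; first exact: cst_continuous.
  by apply: continuousM; [exact: ctc|have [] := dphi ord0 p Cp].
apply: continuousD; first exact: continuousD cA cB.
refine (cvg_big _ (nbhs_filter p) _) => [x|i _].
  by apply: cvgD; [exact: cvg_fst|exact: cvg_snd].
by have [] := dphi (lift ord0 i) p Cp.
Qed.

Let cG x : cone X x -> {for x, continuous G}.
Proof.
move=> Cx; apply: continuousM; first exact: ctc2.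
apply: continuousB; first exact: cont cf _ Cx.
apply: (continuous_comp (f := u)); first exact: cont cu _ Cx.
exact: ch.
Qed.

Lemma viscosity_inequality :
  (\forall q \near within (cone X) (nbhs p), u p - phi p <= u q - phi q) ->
  Lam p <= G p.
Proof.
move=> minp; rewrite leNgt; apply/negP => GL.
have [cphi dphi] := Ck2P oC Cphi.
pose eta := (Lam p - G p) / 4.
have eta0 : 0 < eta by rewrite /eta; lra.
have [rho rho0 Hrho] : exists2 rho, 0 < rho & forall q, ball p rho q ->
    [/\ cone X q, u p - phi p <= u q - phi q, Lam p - eta < Lam q & G q < G p + eta].
  have N1 : \forall q \near p, cone X q by exact: open_nbhs_nbhs.
  have N2 : \forall q \near p, Lam p - eta < Lam q.
    by apply: (cvgr_gt _ cLam); lra.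
  have N3 : \forall q \near p, G q < G p + eta.
    by apply: (cvgr_lt _ (cG Cp)); lra.
  have : \forall q \near p,
    [/\ cone X q, u p - phi p <= u q - phi q, Lam p - eta < Lam q & G q < G p + eta].
    apply: filterS (filterI (filterI N1 N2) (filterI N3 minp)).
    by move=> q [[Cq H2] [H3 H4]]; split=> //; exact: H4.
  by move=> /nbhs_ballP[rho /= rho0 H]; exists rho.
(* The minimum is sought in [N], of radius r; the mollification integrates over [D], of radius 2 r;
   both lie in the ball of radius rho. *)
pose r := rho / 4; have r0 : 0 < r by rewrite /r; lra.
pose lo k (j : 'I_m.+1) := p ord0 j - k.
pose hi k (j : 'I_m.+1) := p ord0 j + k.
set D := box (lo (2 * r)) (hi (2 * r)).
set N := box (lo r) (hi r).
have DP q : D q <-> forall j, `|q ord0 j - p ord0 j| <= 2 * r by exact: box_ballP.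
have NP q : N q <-> forall j, `|q ord0 j - p ord0 j| <= r by exact: box_ballP.
have Drho q : D q -> ball p rho q.
  move=> /DP H; apply/rV_ballP => // j; rewrite distrC.
  by apply: le_lt_trans (H j) _; rewrite /r; lra.
have ND q : N q -> D q.
  by move=> /NP H; apply/DP => j; apply: le_trans (H j) _; lra.
have DC : D `<=` cone X by move=> q /Drho/Hrho[].
have pN : N p by apply/NP => j; rewrite subrr normr0 ltW.
have mD : measurable D by exact: measurable_box.
have iu : mu.-integrable D (EFin \o u) by exact: integrable_box_continuous cu.
have t01 q : D q -> 0 < q ord0 ord0 <= 1.
  by move=> /DC[/andP[? ?] _]; apply/andP; split=> //; exact: ltW.
pose kappa := eta / (2 + 4 * m%:R).
have m0 : 0 <= m%:R :> R by [].
have kappa0 : 0 < kappa by rewrite divr_gt0//; lra.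
(* The admissible mollification error is a quarter of the penalty reached on the faces of [N], as
   [boundary_contradiction] demands. *)
pose delta := kappa * r ^+ 2 / 4.
have delta0 : 0 < delta by rewrite divr_gt0// mulr_gt0// exprn_gt0.
have [e1 e10 He1] : exists2 e, 0 < e &
    forall y q, D y -> ball y e q -> `|u q - u y| <= delta.
  apply: compact_unif_continuous => //; first exact: box_compact.
  by move=> x /DC; exact: cont cu _.
(* e <= r keeps kernels centred in [N] supported in [D]; e < e1 places the closed e-cube around [y]
   in the open ball of uniform continuity. *)
pose e := Order.min r (e1 / 2).
have e0 : 0 < e by rewrite lt_min r0 /=; lra.
have er : e <= r by rewrite ge_min lexx.
have ee1 : e <= e1 / 2 by rewrite ge_min lexx orbT.
have Nsub y j : N y -> lo (2 * r) j <= y ord0 j - e /\ y ord0 j + e <= hi (2 * r) j.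
  move=> /NP/(_ j); rewrite ler_distl /lo /hi => /andP[? ?]; lra.
have [c c0 Hc] := integral_moll D e0.
have {}Hc y : N y -> \int[mu]_(q in D) tens (moll e y) q = c.
  move=> Ny; have y01 := t01 _ (ND _ Ny); apply: Hc; first by case/andP: y01.
  move=> q nDq; apply: (moll_out e0 y01) => yq; apply: nDq; apply/DP => j.
  have -> : q ord0 j - p ord0 j = (q ord0 j - y ord0 j) + (y ord0 j - p ord0 j) by ring.
  have /NP/(_ j) := Ny; have := yq j.
  have := ler_normD (q ord0 j - y ord0 j) (y ord0 j - p ord0 j).
  lra.
pose W := mollify e D u.
have Wub y : N y -> W y <= (u y + delta) * c.
  move=> Ny; rewrite -(Hc y Ny); apply: Rintegral_moll_le => //; first exact/t01/ND.
  move=> q Dq yq; have : `|u q - u y| <= delta.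
    apply: He1; first exact: ND.
    by apply/rV_ballP => // j; rewrite distrC; have := yq j; lra.
  by rewrite ler_distl => /andP[? ?]; lra.
have Wlb y : N y -> (u y - delta) * c <= W y.
  move=> Ny; rewrite -lerN2 -mulNr -(Hc y Ny).
  have -> : - W y = \int[mu]_(q in D) (- u q * tens (moll e y) q).
    rewrite -mulN1r /W /mollify -RintegralZl//; last first.
      by apply: integrable_moll => //; have /andP[] := t01 _ (ND _ Ny).
    by apply: eq_Rintegral => q _; rewrite mulN1r mulNr.
  apply: Rintegral_moll_le => //; [|exact/t01/ND|].
    by have H := integrableN iu; exact: H.
  move=> q Dq yq; have : `|u q - u y| <= delta.
    apply: He1; first exact: ND.
    by apply/rV_ballP => // j; rewrite distrC; have := yq j; lra.
  by rewrite ler_distl => /andP[? ?]; lra.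
pose S (y : 'rV[R]_m.+1) : R := \sum_j (y ord0 j - p ord0 j) ^+ 2.
pose F (y : 'rV[R]_m.+1) : R := W y - c * phi y + c * kappa * S y.
have cS y : {for y, continuous S}.
  refine (cvg_big _ (nbhs_filter y) _) => [x|j _].
    by apply: cvgD; [exact: cvg_fst|exact: cvg_snd].
  apply: (continuous_comp (f := fun q : 'rV[R]_m.+1 => q ord0 j)
    (g := fun t : R => (t - p ord0 j) ^+ 2)); first exact: coord_continuous.
  apply: (continuous_comp (f := fun t : R => t - p ord0 j) (g := fun t : R => t ^+ 2)).
    by apply: continuousB; [exact: cvg_id|exact: cst_continuous].
  exact: exprn_continuous.
have cF : {within N, continuous F}.
  apply: continuous_in_subspaceT => y; rewrite inE => Ny.
  have /andP[y0 _] := t01 _ (ND _ Ny).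
  have cW : {for y, continuous W} by exact: continuous_mollify.
  have c1 : {for y, continuous (fun x => c * phi x)}.
    by apply: continuousM; [exact: cst_continuous|exact/cphi/DC/ND].
  have c2 : {for y, continuous (fun x => c * kappa * S x)}.
    by apply: continuousM; [exact: cst_continuous|exact: cS].
  exact: continuousD (continuousB cW c1) c2.
have [|y /set_mem Ny minF] := @EVT_min_rV R m.+1 F N _ (@box_compact _ _ _ _) cF.
  by exists p.
have {}minF x : N x -> F y <= F x by move=> Nx; apply: minF; rewrite inE.
have [Cy phiy Lamy _] := Hrho y (Drho y (ND y Ny)).
have Sp : S p = 0 by rewrite /S big1// => j _; rewrite subrr expr0n.
have inner j : `|y ord0 j - p ord0 j| < r.
  rewrite ltNge; apply/negP => rj.
  have Sy : r ^+ 2 <= S y.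
    rewrite /S (bigD1 j)//= -(real_normK (num_real (y ord0 j - p ord0 j))).
    apply: (@le_trans _ _ (`|y ord0 j - p ord0 j| ^+ 2)).
      by rewrite lerXn2r ?nnegrE ?normr_ge0 ?(ltW r0).
    by rewrite lerDl sumr_ge0// => k _; exact: sqr_ge0.
  have := minF p pN; rewrite /F Sp mulr0 addr0.
  have := Wub p pN; have := Wlb y Ny.
  have r20 : 0 < r ^+ 2 by exact: exprn_gt0.
  exact: (boundary_contradiction c0 kappa0 r20 phiy Sy erefl).
have y01 := t01 _ (ND _ Ny); have /andP[y0 y1] := y01.
(* Moving one coordinate of [y] by less than its slack stays in [N], so the minimum persists along
   each coordinate line and the one-variable test applies. *)
have Ns i s : `|s - y ord0 i| < r - `|y ord0 i - p ord0 i| -> N (setc y i s).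
  move=> si; apply/NP => j; rewrite setcE; case: eqP => [->|_]; last exact/ltW.
  have := ler_normD (s - y ord0 i) (y ord0 i - p ord0 i).
  by move: si; rewrite ltrBrDr addrA subrK => /[swap] /le_lt_trans /[apply] /ltW.
have order i :
    mollify1 e D u i y =
      c * partial i phi y - c * kappa * (2 * (y ord0 i - p ord0 i)) /\
    c * partial i (partial i phi) y - c * kappa * 2 <= mollify2 e D u i y.
  pose F1 s := mollify1 e D u i (setc y i s) - c * partial i phi (setc y i s)
    + c * kappa * (2 * (s - p ord0 i)).
  pose F2 := mollify2 e D u i y - c * partial i (partial i phi) y + c * kappa * 2.
  have [|s si|||] := @second_order_min R (fun s => F (setc y i s)) F1 (y ord0 i)
      (r - `|y ord0 i - p ord0 i|) F2.
  - by rewrite subr_gt0.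
  - have Nsi := Ns i s si.
    have ips : i == ord0 -> 0 < s.
      move=> /eqP i0; have /andP[+ _] := t01 _ (ND _ Nsi).
      by rewrite setcE i0 eqxx.
    have d1 := is_derive_mollify e0 mD iu y0 ips.
    have [dphi1 _ _ _] := dphi i _ (DC _ (ND _ Nsi)).
    have d2 : is_derive s 1 (fun s => phi (setc y i s)) (partial i phi (setc y i s)).
      by apply/is_derive_setc; exact: DeriveDef.
    have d3 := is_derive_sqr_dist y p i s.
    exact: is_deriveD (is_deriveB d1 (is_deriveZ c d2)) (is_deriveZ (c * kappa) d3).
  - have ips : i == ord0 -> 0 < y ord0 i by move=> /eqP ->.
    have d1 := is_derive_mollify1 e0 mD iu y0 ips.
    have [_ dphi2 _ _] := dphi i _ Cy.
    have d2 : is_derive (y ord0 i) 1 (fun s => partial i phi (setc y i s))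
        (partial i (partial i phi) y).
      by apply/is_derive_setc; rewrite setc_id; exact: DeriveDef.
    have d3 : is_derive (y ord0 i) 1 (fun s => 2 * (s - p ord0 i)) (2 : R).
      rewrite (_ : (fun _ => _) = fun s => 2 * s + - (2 * p ord0 i)).
        exact: is_derive_affine.
      by apply/funext => s; ring.
    have := is_deriveD (is_deriveB d1 (is_deriveZ c d2)) (is_deriveZ (c * kappa) d3).
    by rewrite setc_id; exact.
  - by move=> s /Ns Nsi; rewrite setc_id; exact: minF.
  - rewrite /F1 /F2 setc_id => /eqP H1 H2; split.
      by move: H1; rewrite addr_eq0 subr_eq addrC => /eqP.
    by rewrite -subr_ge0 opprB [X in _ + X]addrC addrA.
have iG : mu.-integrable D (EFin \o G).
  apply: (integrable_box_continuous oC DC).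
  rewrite continuous_open_subspace// => x; rewrite inE => Cx.
  exact: cG.
have up := weak_supersolution_mollify oC ch cf cu su e0 DC y01 (fun j => Nsub y j Ny).
have low : \int[mu]_(q in D) (G q * tens (moll e y) q) <= (G p + eta) * c.
  rewrite -(Hc y Ny); apply: Rintegral_moll_le => // q /Drho/Hrho[_ _ _ /ltW Gq] _.
  exact: Gq.
have {}up := le_trans up low.
have sumW : c * \sum_(i < m) partial (lift ord0 i) (partial (lift ord0 i) phi) y
    - c * kappa * 2 * m%:R <= \sum_(i < m) mollify2 e D u (lift ord0 i) y.
  rewrite mulr_sumr mulr_natr -[m in _ *+ m]card_ord -sumr_const -sumrB.
  by apply: ler_sum => i _; have [] := order (lift ord0 i).
have [W1 W2] := order ord0.
move: up; rewrite W1 => up.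
have keta : kappa * (2 + 4 * m%:R) = eta.
  by rewrite /kappa divfK// gt_eqF//; lra.
have p0 : 0 < p ord0 ord0 by have /andP[] := t01 _ (ND _ pN).
apply: (touching_contradiction c0 kappa0 m0 y01 p0 keta W2 sumW up Lamy _ eta0).
by rewrite /eta; field.
Qed.

End viscosity.

Theorem proposition1p3 (R : realType) (m : nat) (hm : (3 <= m.+1)%N)
  (X : set 'rV[R]_m) (hXbounded : bounded_set X) (hXconvex : convex_set X)
  (hXopen : open X) (hXsmooth : smooth_boundary X)
  (h : R -> R) (hh_cont : continuous h)
  (hh_mono : forall a b, a <= b -> h b <= h a) (hh0 : h 0 = 0)
  (f : 'rV[R]_m.+1 -> R) (hf : {within cone X, continuous f})
  (gamma : R) (u : 'rV[R]_m.+1 -> R)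
  (huH : weighted_H1 X gamma u) (hucont : {within cone X, continuous u})
  (husuper : weak_supersolution X gamma h f u) :
  viscosity_supersolution X h f u.
Proof.
have oC : open (cone X) := open_cone hXopen.
split=> [p Cp a au|phi Cphi p Cp minp].
  have cup : {for p, continuous u}.
    by move: hucont; rewrite continuous_open_subspace// => cu; apply: cu; rewrite inE.
  have : \forall q \near p, a < u q by exact: (cvgr_gt _ cup).
  by apply: filterS => q.
have := viscosity_inequality oC hh_cont hf hucont husuper Cphi Cp minp.
rewrite -(cone_operatorE oC Cphi Cp) -subr_ge0 => H.
have [/andP[t0 _] _] := Cp.
(* [viscosity_inequality] carries the factor t^2; multiplying by t^-2 >= 0 restores the stated
   form. *)
have t2 : 0 <= tc p ^- 2 by rewrite invr_ge0 exprn_ge0// ltW.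
rewrite -subr_ge0; apply: le_trans (mulr_ge0 t2 H) _.
rewrite le_eqVlt; apply/orP; left; apply/eqP.
by field; rewrite gt_eqF.
Qed.
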